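(* Let $C$ be a hyperelliptic curve of genus $g\geq 1$ defined over $\mathbb{Q}$, with a rational Weierstrass point. Choose an affine equation of $C$ of the form $y^2=f(x)$, where $f\in\mathbb{Z}[x]$ is a square-free monic polynomial of degree $2g+1$. Let $\mathcal{W}=\mathrm{Spec}(\mathbb{Z}[x,y]/(y^2-f(x)))\to\mathrm{Spec}(\mathbb{Z})$ be the integral affine scheme defined by this equation. For each $n\in\mathbb{Z}$ such that $f(n)<0$, let $$T_n:\mathrm{Spec}(\mathbb{Z}[\sqrt{f(n)}])\longrightarrow \mathcal{W}$$ be the canonical section (i.e. the closed subscheme of $\mathcal{W}$ defined by the equation $x=n$). Then for any non-trivial $\mathcal{L}\in\mathrm{Pic}(\mathcal{W})$, there exist infinitely many $n\in\mathbb{Z}_{<0}$ (with $f(n)<0$) such that $T_n^*\mathcal{L}\neq 0$ in $\mathrm{Pic}(\mathbb{Z}[\sqrt{f(n)}])$. In particular, if $\mathcal{L}$ has infinite order, then the order of $T_n^*\mathcal{L}$ is unbounded when $n\to-\infty$.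
   Context: A hyperelliptic curve over a field $k$ is a smooth projective geometrically connected $k$-curve of genus $g\geq 1$ endowed with a degree $2$ map $C\to\mathbb{P}^1_k$ (this includes elliptic curves); its Weierstrass points are the ramification points of this map. Picard groups are written additively. Since $f$ is monic of odd degree, $f(n)<0$ for all sufficiently negative integers $n$; when $f(n)<0$, $\mathbb{Z}[\sqrt{f(n)}]$ is an order of discriminant $4f(n)$ in the imaginary quadratic field $\mathbb{Q}(\sqrt{f(n)})$. *)

(* Defs.v *)
From HB Require Import structures.
From mathcomp Require Import all_boot all_order all_algebra.
From mathcomp Require Import boolp classical_sets cardinality.

Set Implicit Arguments.
Unset Strict Implicit.
Unset Printing Implicit Defensive.

Import Order.TTheory GRing.Theory Num.Theory.
Local Open Scope ring_scope.
Local Open Scope quotient_scope.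

(* The tensor product of M and N over R, where M is an S-module seen as an
   R-module through phi : R -> S, and with S acting on the left factor.
   A sequence [:: (m1, n1); ...; (mk, nk)] stands for the formal sum
   m1 (x) n1 + ... + mk (x) nk; tensor_eq is the congruence generated by
   bilinearity.  For phi = id this is the usual tensor product, and for
   M = S it is the extension of scalars of N along phi. *)
Section Tensor.
Variables (R S : comNzRingType) (phi : {rmorphism R -> S}).
Variables (M : lmodType S) (N : lmodType R).

Inductive tensor_eq : seq (M * N) -> seq (M * N) -> Prop :=
| tensor_eq_refl s : tensor_eq s s
| tensor_eq_sym s t : tensor_eq s t -> tensor_eq t s
| tensor_eq_trans t s u : tensor_eq s t -> tensor_eq t u -> tensor_eq s u
| tensor_eq_cat s s' t t' :
    tensor_eq s s' -> tensor_eq t t' -> tensor_eq (s ++ t) (s' ++ t')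
| tensor_eq_catC s t : tensor_eq (s ++ t) (t ++ s)
| tensor_eq_0l n : tensor_eq [:: (0, n)] [::]
| tensor_eq_Dl m m' n : tensor_eq [:: (m + m', n)] [:: (m, n); (m', n)]
| tensor_eq_Dr m n n' : tensor_eq [:: (m, n + n')] [:: (m, n); (m, n')]
| tensor_eq_Z r m n : tensor_eq [:: (phi r *: m, n)] [:: (m, r *: n)].

Definition tensor_rel : rel (seq (M * N)) := fun s t => `[< tensor_eq s t >].

Lemma tensor_rel_refl : reflexive tensor_rel.
Proof. by move=> s; apply/asboolP/tensor_eq_refl. Qed.

Lemma tensor_rel_sym : symmetric tensor_rel.
Proof. by move=> s t; apply/asboolP/asboolP => /tensor_eq_sym. Qed.

Lemma tensor_rel_trans : transitive tensor_rel.
Proof.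
by move=> t s u /asboolP st /asboolP tu; apply/asboolP/(tensor_eq_trans st tu).
Qed.

Canonical tensor_equiv :=
  EquivRel tensor_rel tensor_rel_refl tensor_rel_sym tensor_rel_trans.

Definition tensor := {eq_quot tensor_rel}.
HB.instance Definition _ := EqQuotient.on tensor.
HB.instance Definition _ := Choice.on tensor.

Definition tensor_of (s : seq (M * N)) : tensor := \pi s.

Lemma tensor_ofP s t : tensor_of s = tensor_of t <-> tensor_eq s t.
Proof. by split=> [/eqmodP/asboolP|st]; last apply/eqmodP/asboolP. Qed.

Lemma tensorW (P : tensor -> Prop) :
  (forall s, P (tensor_of s)) -> forall x, P x.
Proof. by move=> Ps; exact: quotW. Qed.

Definition tensor_map (h : M -> M) (s : seq (M * N)) : seq (M * N) :=
  [seq (h x.1, x.2) | x <- s].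

Definition tensor_zero : tensor := tensor_of [::].
Definition tensor_add (x y : tensor) : tensor := tensor_of (repr x ++ repr y).
Definition tensor_opp (x : tensor) : tensor :=
  tensor_of (tensor_map -%R (repr x)).
Definition tensor_scale (a : S) (x : tensor) : tensor :=
  tensor_of (tensor_map ( *:%R a) (repr x)).

Lemma repr_tensor_of s : tensor_eq (repr (tensor_of s)) s.
Proof. by apply/tensor_ofP; rewrite /tensor_of reprK. Qed.

Lemma tensor_eq_map (h : {additive M -> M}) s t :
  (forall r m, h (phi r *: m) = phi r *: h m) ->
  tensor_eq s t -> tensor_eq (tensor_map h s) (tensor_map h t).
Proof.
move=> hZ; elim=> {s t} /=.
- by move=> s; exact: tensor_eq_refl.
- by move=> s t _; exact: tensor_eq_sym.
- by move=> t s u _ st _; exact: tensor_eq_trans.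
- by move=> s s' t t' _ ss _ tt; rewrite /tensor_map !map_cat; exact: tensor_eq_cat.
- by move=> s t; rewrite /tensor_map !map_cat; exact: tensor_eq_catC.
- by move=> n; rewrite raddf0; exact: tensor_eq_0l.
- by move=> m m' n; rewrite raddfD; exact: tensor_eq_Dl.
- by move=> m n n'; exact: tensor_eq_Dr.
- by move=> r m n; rewrite hZ; exact: tensor_eq_Z.
Qed.

Lemma tensor_addE s t :
  tensor_add (tensor_of s) (tensor_of t) = tensor_of (s ++ t).
Proof. by apply/tensor_ofP/tensor_eq_cat; exact: repr_tensor_of. Qed.

Lemma tensor_oppE s : tensor_opp (tensor_of s) = tensor_of (tensor_map -%R s).
Proof.
apply/tensor_ofP/(tensor_eq_map (h := -%R)); last exact: repr_tensor_of.
by move=> r m; rewrite scalerN.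
Qed.

Lemma tensor_scaleE a s :
  tensor_scale a (tensor_of s) = tensor_of (tensor_map ( *:%R a) s).
Proof.
apply/tensor_ofP/(tensor_eq_map (h := *:%R a)); last exact: repr_tensor_of.
by move=> r m; rewrite /= !scalerA [a * _]mulrC.
Qed.

Lemma tensor_addA : associative tensor_add.
Proof.
elim/tensorW=> s; elim/tensorW=> t; elim/tensorW=> u.
by rewrite !tensor_addE catA.
Qed.

Lemma tensor_addC : commutative tensor_add.
Proof.
elim/tensorW=> s; elim/tensorW=> t; rewrite !tensor_addE.
by apply/tensor_ofP/tensor_eq_catC.
Qed.

Lemma tensor_add0 : left_id tensor_zero tensor_add.
Proof. by elim/tensorW=> s; rewrite tensor_addE. Qed.

Lemma tensor_of_cons m n s :
  tensor_of ((m, n) :: s) = tensor_add (tensor_of [:: (m, n)]) (tensor_of s).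
Proof. by rewrite tensor_addE. Qed.

Lemma tensor_of_pureD m m' n :
  tensor_of [:: (m + m', n)] =
  tensor_add (tensor_of [:: (m, n)]) (tensor_of [:: (m', n)]).
Proof. by rewrite tensor_addE; apply/tensor_ofP/tensor_eq_Dl. Qed.

Lemma tensor_addN : left_inverse tensor_zero tensor_opp tensor_add.
Proof.
elim/tensorW; elim=> [|[m n] s IHs]; first by rewrite tensor_oppE tensor_addE.
rewrite tensor_oppE /= (tensor_of_cons m) tensor_of_cons.
rewrite -tensor_addA (tensor_addA (tensor_of (tensor_map _ s))).
rewrite (tensor_addC (tensor_of (tensor_map _ s))) -tensor_addA -tensor_oppE.
rewrite IHs (tensor_addC _ tensor_zero) tensor_add0 -tensor_of_pureD addNr.
by apply/tensor_ofP/tensor_eq_0l.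
Qed.

HB.instance Definition _ := GRing.isZmodule.Build tensor
  tensor_addA tensor_addC tensor_add0 tensor_addN.

Lemma tensor_scaleA a b x :
  tensor_scale a (tensor_scale b x) = tensor_scale (a * b) x.
Proof.
elim/tensorW: x => s; rewrite !tensor_scaleE /tensor_map -map_comp.
by congr tensor_of; apply: eq_map => -[m n] /=; rewrite scalerA.
Qed.

Lemma tensor_scale1 : left_id 1 tensor_scale.
Proof.
elim/tensorW=> s; rewrite tensor_scaleE; congr tensor_of.
by rewrite -[RHS]map_id; apply: eq_map => -[m n] /=; rewrite scale1r.
Qed.

Lemma tensor_scaleDr : right_distributive tensor_scale +%R.
Proof.
move=> a; elim/tensorW=> s; elim/tensorW=> t.
by rewrite /GRing.add /= tensor_addE !tensor_scaleE tensor_addE /tensor_map map_cat.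
Qed.

Lemma tensor_scaleDl x : {morph tensor_scale^~ x : a b / a + b}.
Proof.
move=> a b; elim/tensorW: x; elim=> [|[m n] s IHs].
  by rewrite !tensor_scaleE [RHS]tensor_addE.
rewrite !tensor_scaleE in IHs *; rewrite /= tensor_of_cons IHs scalerDl.
rewrite tensor_of_pureD (tensor_of_cons (a *: m)) (tensor_of_cons (b *: m)).
exact: (@addrACA tensor).
Qed.

HB.instance Definition _ := GRing.Zmodule_isLmodule.Build S tensor
  tensor_scaleA tensor_scale1 tensor_scaleDr tensor_scaleDl.

End Tensor.

Section Picard.
Variable R : comNzRingType.
Implicit Types L M : lmodType R.

Definition isomorphic L M : Prop := exists h : {linear L -> M}, bijective h.

Definition tensor_product L M : lmodType R :=
  tensor (idfun : {rmorphism R -> R}) L M.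

Fixpoint tensor_power L (k : nat) : lmodType R :=
  if k is k'.+1 then tensor_product L (tensor_power L k') else R^o.

(* Line bundles on Spec R are the invertible R-modules, and Pic(Spec R) is the
   group of their isomorphism classes under the tensor product.  In additive
   notation, the class of L is 0 when L is isomorphic to R, and k times the
   class of L is the class of [tensor_power L k].  [order_gt b L] says that
   the order of the class of L in Pic(Spec R), an element of
   {1, 2, 3, ...} or infinity, is greater than b. *)
Definition invertible L : Prop := exists M, isomorphic (tensor_product L M) R^o.

Definition pic_zero L : Prop := isomorphic L R^o.

Definition infinite_order L : Prop :=
  forall k : nat, (0 < k)%N -> ~ pic_zero (tensor_power L k).

Definition order_gt (b : nat) L : Prop :=
  forall k : nat, (0 < k <= b)%N -> ~ pic_zero (tensor_power L k).

End Picard.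

(* The pull-back of L along Spec S -> Spec R, i.e. its extension of scalars. *)
Definition pullback (R S : comNzRingType) (phi : {rmorphism R -> S})
  (L : lmodType R) : lmodType S := tensor phi S^o L.

(* A[y] / (y^2 - d) *)
Definition sqrt_ring (A : comNzRingType) (d : A) : comNzRingType :=
  {poly %/ 'X^2 - d%:P}.

Section SqrtMap.
Variables (A B : comNzRingType) (phi : {rmorphism A -> B}) (d : A).

(* {poly %/ h} is the quotient by h only when h is monic and nonconstant. *)
Lemma mk_monic_sqrt (C : comNzRingType) (c : C) :
  mk_monic ('X^2 - c%:P) = 'X^2 - c%:P.
Proof. by rewrite /mk_monic size_XnsubC // monicXnsubC. Qed.

(* The map A[y] / (y^2 - d) -> B[y] / (y^2 - phi d) given by phi on A and
   y |-> y. *)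
Definition sqrt_map (p : sqrt_ring d) : sqrt_ring (phi d) :=
  in_qpoly _ (map_poly phi (val p)).

Lemma sqrt_map_in_qpoly (p : {poly A}) :
  sqrt_map (in_qpoly _ p) = in_qpoly _ (map_poly phi p).
Proof.
have mon (C : comNzRingType) (c : C) : 'X^2 - c%:P \is monic.
  by rewrite monicXnsubC.
rewrite /sqrt_map /= mk_monic_sqrt.
rewrite [in RHS](Pdiv.RingMonic.rdivp_eq (mon _ d) p) rmorphD rmorphM /=.
rewrite in_qpolyD; apply: val_inj => /=; rewrite mk_monic_sqrt.
rewrite [map_poly phi ('X^2 - _)]rmorphB /= map_polyXn map_polyC /=.
by rewrite Pdiv.RingMonic.rmodp_mull ?mon // add0r.
Qed.

Lemma sqrt_map_is_zmod_morphism : zmod_morphism sqrt_map.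
Proof. by move=> p q; rewrite /sqrt_map !raddfB. Qed.

Lemma sqrt_map_is_monoid_morphism : monoid_morphism sqrt_map.
Proof.
split=> [|p q].
  by rewrite -(in_qpoly1 ('X^2 - d%:P)) sqrt_map_in_qpoly rmorph1 in_qpoly1.
have -> : p * q = in_qpoly _ (val p * val q) by [].
by rewrite sqrt_map_in_qpoly rmorphM in_qpolyM.
Qed.

HB.instance Definition _ :=
  GRing.isZmodMorphism.Build (sqrt_ring d) (sqrt_ring (phi d)) sqrt_map
    sqrt_map_is_zmod_morphism.
HB.instance Definition _ :=
  GRing.isMonoidMorphism.Build (sqrt_ring d) (sqrt_ring (phi d)) sqrt_map
    sqrt_map_is_monoid_morphism.

End SqrtMap.

Definition square_free (A : idomainType) (f : {poly A}) : Prop :=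
  forall d e : {poly A}, f = d ^+ 2 * e -> d \is a GRing.unit.

(* The coordinate ring Z[x,y] / (y^2 - f(x)) of the integral affine scheme W,
   and the ring Z[sqrt(f(n))] = Z[x,y] / (y^2 - f(x), x - n). *)
Definition coord_ring (f : {poly int}) : comNzRingType := sqrt_ring f.
Definition section_ring (f : {poly int}) (n : int) : comNzRingType :=
  sqrt_ring f.[n].

(* The ring map x |-> n, y |-> sqrt(f(n)) dual to the section T_n. *)
Definition section_map (f : {poly int}) (n : int) :
    {rmorphism coord_ring f -> section_ring f n} :=
  (sqrt_map (horner_eval n) (d := f) :
    {rmorphism sqrt_ring f -> sqrt_ring (horner_eval n f)}).

(* Main.v *)
(* Write R = Z[x, y] / (y ^ 2 - f), and N (u + v y) = u ^ 2 - f v ^ 2.  As f has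
   odd degree, the two terms of N never cancel, so that deg N behaves like a
   valuation.  Let I be an ideal of R isomorphic to the given line bundle, let a
   be an element of I minimizing deg N, and b one minimizing deg N among those
   with the other parity.  Then (a, b) is a reduced basis of I over Q[x], and for
   n near -oo the reduction of a is, up to a bounded denominator, a shortest
   vector of the lattice I_n in the imaginary quadratic order Z[sqrt (f n)].  If
   I_n is principal for such an n, then a_n is the generator of I_n times an
   element of bounded norm, hence times a bounded integer as f n is large.  If
   this happens for infinitely many n, then a generates I over Q[x, y].

   It remains to see that the kernel of Pic R -> Pic (R (x) Q) is trivial: modulo
   each prime p, f still has odd degree, so p R is prime, and by a Gauss lemma an
   invertible ideal that becomes principal over Q is already principal.  The second claim is the first one for the powers of L. *)
Require Import Defs.
From HB Require Import structures.
From mathcomp Require Import all_boot all_order all_algebra.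
From mathcomp Require Import boolp classical_sets cardinality.
From mathcomp Require Import zify ring.

Set Implicit Arguments.
Unset Strict Implicit.
Unset Printing Implicit Defensive.

Import Order.TTheory GRing.Theory Num.Theory.
Local Open Scope ring_scope.

(** * Quadratic extensions *)


Section SqrtRing.
Context {A : comNzRingType} {d : A}.
Implicit Types (p q : sqrt_ring d) (u v s t : A).

Definition surd u v : sqrt_ring d := in_qpoly _ (u%:P + v *: 'X).
Definition re p : A := (val p)`_0.
Definition im p : A := (val p)`_1.

Lemma val_surd u v : val (surd u v) = u%:P + v *: 'X.
Proof.
apply: in_qpoly_small; rewrite mk_monic_sqrt size_XnsubC //.
rewrite (leq_ltn_trans (size_polyD _ _)) // gtn_max.
rewrite (leq_ltn_trans (size_polyC_leq1 _)) //.
by rewrite (leq_ltn_trans (size_scale_leq _ _)) // size_polyX.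
Qed.

Lemma re_surd u v : re (surd u v) = u.
Proof. by rewrite /re val_surd coefD coefC coefZ coefX mulr0 addr0. Qed.

Lemma im_surd u v : im (surd u v) = v.
Proof. by rewrite /im val_surd coefD coefC coefZ coefX mulr1 add0r. Qed.

Lemma surdE p : p = surd (re p) (im p).
Proof.
apply: val_inj; rewrite val_surd; apply/polyP => i.
rewrite coefD coefC coefZ coefX.
case: i => [|[|i]] /=; rewrite ?mulr0 ?mulr1 ?addr0 ?add0r //.
apply: nth_default; apply: leq_trans (_ : 2 <= _)%N => //.
by rewrite -ltnS (leq_trans (size_mk_monic p)) // mk_monic_sqrt size_XnsubC.
Qed.

Lemma surdW (P : sqrt_ring d -> Prop) : (forall u v, P (surd u v)) -> forall p, P p.
Proof. by move=> h p; rewrite [p]surdE. Qed.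

Lemma surd_inj u v s t : surd u v = surd s t -> u = s /\ v = t.
Proof.
by move=> e; split; [rewrite -(re_surd u v)|rewrite -(im_surd u v)];
   rewrite e ?re_surd ?im_surd.
Qed.

Lemma surd0 : surd 0 0 = 0.
Proof. by apply: val_inj; rewrite val_surd scale0r addr0. Qed.

Lemma surdD u v s t : surd u v + surd s t = surd (u + s) (v + t).
Proof.
apply: val_inj; rewrite val_surd.
have -> : val (surd u v + surd s t) = val (surd u v) + val (surd s t) by [].
by rewrite !val_surd scalerDl polyCD addrACA.
Qed.

Lemma surdN u v : - surd u v = surd (- u) (- v).
Proof.
apply: val_inj; rewrite val_surd.
have -> : val (- surd u v) = - val (surd u v) by [].
by rewrite !val_surd scaleNr polyCN opprD.
Qed.

Lemma surdM u v s t :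
  surd u v * surd s t = surd (u * s + d * v * t) (u * t + v * s).
Proof.
rewrite -[LHS]in_qpolyM.
have -> : (u%:P + v *: 'X) * (s%:P + t *: 'X) =
  ((u * s + d * v * t)%:P + (u * t + v * s) *: 'X) + (v * t)%:P * ('X^2 - d%:P).
  rewrite -!mul_polyC !(polyCD, polyCM); ring.
rewrite in_qpolyD -[X in _ = X]addr0; congr (_ + _).
apply: val_inj => /=; rewrite mk_monic_sqrt.
by rewrite Pdiv.RingMonic.rmodp_mull ?monicXnsubC.
Qed.

Lemma surd1 : surd 1 0 = 1.
Proof. by rewrite /surd scale0r addr0 -[RHS]in_qpoly1. Qed.

Definition surd_conj p : sqrt_ring d := surd (re p) (- im p).
Definition qnorm p : A := re p ^+ 2 - d * im p ^+ 2.

Lemma qnormM p q : qnorm (p * q) = qnorm p * qnorm q.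
Proof.
elim/surdW: p => u v; elim/surdW: q => s t.
rewrite surdM /qnorm !re_surd !im_surd; ring.
Qed.

Lemma qnorm_surd0 u : qnorm (surd u 0) = u ^+ 2.
Proof. by rewrite /qnorm re_surd im_surd expr0n mulr0 subr0. Qed.

Lemma mul_surd_conj p : p * surd_conj p = surd (qnorm p) 0.
Proof.
elim/surdW: p => u v; rewrite /surd_conj /qnorm !re_surd !im_surd surdM.
congr surd; ring.
Qed.

End SqrtRing.
Arguments surd {A} d u v.

Lemma section_map_surd (f : {poly int}) n u v :
  section_map f n (surd f u v) = surd f.[n] u.[n] v.[n].
Proof.
rewrite /section_map /= /surd sqrt_map_in_qpoly rmorphD /= map_polyC /=.
by rewrite -!mul_polyC rmorphM /= map_polyX map_polyC.
Qed.

Lemma section_map_surj (f : {poly int}) n (p : section_ring f n) :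
  exists q, section_map f n q = p.
Proof.
exists (surd f (re p)%:P (im p)%:P).
by rewrite section_map_surd !hornerC -surdE.
Qed.

(** * The norm on the coordinate ring *)


Section Parity.
Context {A : idomainType} {f : {poly A}}.
Hypothesis f_monic : f \is monic.
Hypothesis f_even : ~~ odd (size f).
Implicit Types u v : {poly A}.

Lemma size_sqr_poly u : size (u ^+ 2) = (size u).*2.-1.
Proof.
have [->|u0] := eqVneq u 0; first by rewrite expr0n size_poly0.
by rewrite expr2 size_mul // addnn.
Qed.

Lemma size_monic_mul_sqr v : v != 0 -> size (f * v ^+ 2) = (size f + (size v).*2)%N.-2.
Proof.
move=> v0; rewrite size_monicM ?expf_neq0 // size_sqr_poly.
by have := size_poly_gt0 v; rewrite v0; lia.
Qed.

(** As [size] is one more than the degree, [f_even] says that f has odd degree. Hence a nonzero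
    [u ^+ 2] has odd size and a nonzero [f * v ^+ 2] has even size, and their leading terms never
    meet. *)
Lemma norm_dominant u v :
  [\/ u = 0 /\ v = 0, (size (f * v ^+ 2)%R < size (u ^+ 2)%R)%N |
      (size (u ^+ 2)%R < size (f * v ^+ 2)%R)%N].
Proof.
have f_gt0 : (0 < size f)%N by rewrite size_poly_gt0 monic_neq0.
have [->|u0] := eqVneq u 0; have [->|v0] := eqVneq v 0.
- by constructor 1.
- constructor 3; rewrite expr0n size_poly0 size_monic_mul_sqr //.
  by move: v0 f_gt0 f_even; rewrite -size_poly_gt0; lia.
- constructor 2; rewrite expr0n mulr0 size_poly0 size_sqr_poly.
  by move: u0; rewrite -size_poly_gt0; lia.
have : size (f * v ^+ 2) <> size (u ^+ 2).
  rewrite size_monic_mul_sqr // size_sqr_poly.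
  by move: u0 v0 f_gt0 f_even; rewrite -!size_poly_gt0; lia.
have [lt|lt|->//] := ltngtP (size (f * v ^+ 2)) (size (u ^+ 2)) => _.
  by constructor 2.
by constructor 3.
Qed.

Lemma norm_eq0 u v : u ^+ 2 - f * v ^+ 2 = 0 -> u = 0 /\ v = 0.
Proof.
move=> /subr0_eq e; by have [//||] := norm_dominant u v; rewrite e ltnn.
Qed.

(** The parity of the size tells which of the two terms leads; odd size leaves only [u ^+ 2]. *)
Lemma norm_odd u v : odd (size (u ^+ 2 - f * v ^+ 2)) ->
  size (u ^+ 2 - f * v ^+ 2) = (size u).*2.-1 /\
  lead_coef (u ^+ 2 - f * v ^+ 2) = lead_coef u ^+ 2.
Proof.
have f_gt0 : (0 < size f)%N by rewrite size_poly_gt0 monic_neq0.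
have [[-> ->]|lt|lt] := norm_dominant u v.
- by rewrite expr0n mulr0 subr0 size_poly0.
- rewrite size_polyDl ?size_polyN // lead_coefDl ?size_polyN //.
  by rewrite lead_coef_exp size_sqr_poly.
- rewrite addrC size_polyDl ?size_polyN //.
  have v0 : v != 0 by apply: contraTneq lt => ->; rewrite expr0n mulr0 size_poly0.
  rewrite size_monic_mul_sqr //.
  by move: v0 f_gt0 f_even; rewrite -size_poly_gt0; lia.
Qed.

Lemma norm_even u v : u ^+ 2 - f * v ^+ 2 != 0 ->
  ~~ odd (size (u ^+ 2 - f * v ^+ 2)) ->
  (size (u ^+ 2)%R < size (u ^+ 2 - f * v ^+ 2)%R)%N.
Proof.
have [[-> ->]|lt|lt] := norm_dominant u v.
- by rewrite expr0n mulr0 subr0 eqxx.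
- move=> _; rewrite size_polyDl ?size_polyN // size_sqr_poly.
  by move: lt; rewrite size_sqr_poly; lia.
- by rewrite addrC size_polyDl ?size_polyN.
Qed.

End Parity.

(** * Division with respect to the degree of the norm *)

Section CoordRing.
Context {f : {poly int}}.
Hypothesis f_monic : f \is monic.
Hypothesis f_even : ~~ odd (size f).
Implicit Types p q : coord_ring f.

Local Notation cst a := (surd f a 0).
Local Notation wt p := (size (qnorm (d := f) p)).

Lemma qnorm_eq0 p : qnorm (d := f) p = 0 -> p = 0.
Proof.
by move=> /(norm_eq0 f_monic f_even)[r i]; rewrite (surdE (d := f) p) r i surd0.
Qed.

Lemma qnorm0 : qnorm (0 : sqrt_ring f) = 0.
Proof. by rewrite -surd0 /qnorm re_surd im_surd expr0n mulr0 subr0. Qed.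

Lemma coord_domain p q : p * q = 0 -> p = 0 \/ q = 0.
Proof.
move=> /(congr1 (@qnorm _ f)); rewrite qnorm0 (qnormM (d := f)) => /eqP.
by rewrite mulf_eq0 => /orP[]/eqP/qnorm_eq0; [left|right].
Qed.

Lemma coord_mulI p q q' : p <> 0 -> p * q = p * q' -> q = q'.
Proof.
move=> p0 /eqP; rewrite -subr_eq0 -mulrBr => /eqP/coord_domain[//|].
by move/subr0_eq.
Qed.

Lemma cst_eq0 (a : {poly int}) : cst a = 0 -> a = 0.
Proof. by rewrite -(surd0 (d := f)) => /surd_inj[]. Qed.

Lemma cstM (a b : {poly int}) : cst (a * b) = cst a * cst b.
Proof. by rewrite surdM; congr surd; ring. Qed.

Lemma cstD (a b : {poly int}) : cst (a + b) = cst a + cst b.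
Proof. by rewrite surdD addr0. Qed.

Lemma qnorm_conj p : qnorm (surd_conj (d := f) p) = qnorm (d := f) p.
Proof.
elim/(surdW (d := f)): p => u v; rewrite /qnorm /surd_conj !re_surd !im_surd; ring.
Qed.

Lemma wtM p q : p <> 0 -> q <> 0 -> wt (p * q) = (wt p + wt q)%N.-1.
Proof.
move=> p0 q0; rewrite (qnormM (d := f)) size_mul //; apply/eqP.
  by move/qnorm_eq0.
by move/qnorm_eq0.
Qed.

Lemma wt_gt0 p : p <> 0 -> (0 < wt p)%N.
Proof. by move=> p0; rewrite size_poly_gt0; apply/eqP => /qnorm_eq0. Qed.

Lemma qnorm_lin (r s : {poly int}) p q :
  qnorm (d := f) (cst r * p + cst s * q) =
  r ^+ 2 * qnorm (d := f) p + (r * s * re (p * surd_conj (d := f) q)) *+ 2 +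
  s ^+ 2 * qnorm (d := f) q.
Proof.
elim/(surdW (d := f)): p => u v; elim/(surdW (d := f)): q => u' v'.
rewrite /surd_conj !re_surd !im_surd !surdM surdD /qnorm !re_surd !im_surd; ring.
Qed.

(** Here x, y and z are [wt p], [wt q] and [size U] of [wt_reduce]: z lies half way between x and y,
    and its distance k to either is the exponent in the multiplier. *)
Let size_arith (x y z : nat) : (0 < x)%N -> (0 < y)%N -> (x <= y)%N ->
  odd x = odd y -> (y + x)%N.-1 = z.*2.-1 ->
  z = (x + (z - x))%N /\ y = (x + (z - x) + (z - x))%N.
Proof. by clear; lia. Qed.

(** The terms in Q, U and P of [reduce_identity] are read at the indices j, j - k and j - k - k.
    Beyond j = y - 1 all three vanish; at j = y - 1 they are leading coefficients. *)
Let index_arith (x y z k j : nat) :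
  (0 < x)%N -> z = (x + k)%N -> y = (x + k + k)%N -> (y.-1 <= j)%N ->
  [/\ (j < k)%N = false, (j - k < k)%N = false,
      j = y.-1 -> (j - k = z.-1)%N, (z.-1 - k = x.-1)%N &
      (y.-1 < j -> [&& y <= j, z <= j - k & x <= j - k - k])%N].
Proof. by clear; split; lia. Qed.

Let reduce_identity (T : comNzRingType) (a l X U P Q : T) :
  a ^+ 2 * Q + a * - (l * X) * U *+ 2 + (- (l * X)) ^+ 2 * P =
  a * (a * Q) - a * (l * (U * X)) *+ 2 + l * (l * (P * X * X)).
Proof. by ring. Qed.

(* [q * surd_conj p] has odd weight, so the square of the leading coefficient of
   its real part is that of its norm; this makes the leading terms cancel. *)
Lemma wt_reduce p q : p <> 0 -> q <> 0 -> odd (wt p) = odd (wt q) ->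
  (wt p <= wt q)%N ->
  exists (c : int) (r : {poly int}), c != 0 /\
    (wt (cst c%:P * q - cst r * p) < wt q)%N.
Proof.
move=> p0 q0 par le.
set w := q * surd_conj (d := f) p.
have Nw : qnorm (d := f) w = qnorm (d := f) q * qnorm (d := f) p.
  by rewrite (qnormM (d := f)) qnorm_conj.
have cp0 : surd_conj (d := f) p <> 0.
  by move=> e; apply: p0; apply: qnorm_eq0; rewrite -qnorm_conj e qnorm0.
have wtw : wt w = (wt q + wt p)%N.-1 by rewrite wtM // qnorm_conj.
have := wt_gt0 p0; have := wt_gt0 q0 => wq wp.
have [|] := @norm_odd _ _ f_monic f_even (re (d := f) w) (im (d := f) w).
  by rewrite -/(qnorm (d := f) w) wtw; lia.
rewrite -/(qnorm (d := f) w) wtw Nw lead_coefM => szU lcU.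
set U := re (d := f) w in szU lcU.
pose k := (size U - wt p)%N.
(* The quotient q / p equals w / N(p), whose real part U / N(p) has as leading term X^k times the
   ratio of the leading coefficients of U and N(p). *)
exists (lead_coef (qnorm (d := f) p)), ((lead_coef U)%:P * 'X^k); split.
  by rewrite lead_coef_eq0; apply/eqP => /qnorm_eq0.
set a := lead_coef (qnorm (d := f) p) in lcU *.
have -> : cst a%:P * q - cst ((lead_coef U)%:P * 'X^k) * p =
          cst a%:P * q + cst (- ((lead_coef U)%:P * 'X^k)) * p.
  by congr (_ + _); rewrite -mulNr surdN oppr0.
rewrite qnorm_lin -/w -/U.
set P := qnorm (d := f) p in a lcU szU wtw wp le par k Nw *.
set Q := qnorm (d := f) q in lcU szU wtw wq le par Nw *.
have [szUe szQ] := size_arith wp wq le par szU; rewrite -/k in szUe szQ.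
rewrite reduce_identity.
rewrite -(prednK wq) ltnS; apply/leq_sizeP => j jQ.
have [jk jkk jU UP jlt] := index_arith wp szUe szQ jQ.
rewrite !coefD coefN coefMn !coefCM !coefMXn jk jkk.
(* Only the coefficient at j = [wt q] - 1 needs a cancellation, and [lcU] provides it. *)
move: jQ; rewrite leq_eqVlt => /predU1P[e|/jlt/and3P[jQ jU' jP]]; last first.
  by rewrite !nth_default ?mulr0 ?mul0rn ?subr0 ?addr0.
rewrite jU // UP -e -!/(lead_coef _) -/a.
have -> : a * (a * lead_coef Q) - a * (lead_coef U * lead_coef U) *+ 2 +
   lead_coef U * (lead_coef U * a) = a * (lead_coef Q * a - lead_coef U ^+ 2) by ring.
by rewrite lcU subrr mulr0.
Qed.

(** Descent on [wt p]: p has the parity of a or of b, and by minimality that one is no heavier than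
    p, so [wt_reduce] applies. The integer c collects the leading coefficients used as
    denominators. *)
Lemma euclid_basis (I : coord_ring f -> Prop) a b :
  (forall p q, I p -> I q -> I (p + q)) -> (forall r p, I p -> I (r * p)) ->
  a <> 0 -> b <> 0 -> I a -> I b -> odd (wt a) != odd (wt b) ->
  (forall p, I p -> p <> 0 -> odd (wt p) = odd (wt a) -> (wt a <= wt p)%N) ->
  (forall p, I p -> p <> 0 -> odd (wt p) = odd (wt b) -> (wt b <= wt p)%N) ->
  forall p, I p -> exists (c : int) (u v : {poly int}),
    c != 0 /\ cst c%:P * p = cst u * a + cst v * b.
Proof.
move=> ID IM a0 b0 Ia Ib par mina minb p.
have [n] := ubnP (wt p); elim: n p => // n IHn p wtp Ip.
have [->|/eqP p0] := eqVneq p 0.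
  exists 1, 0, 0; split => //.
  by rewrite (surd0 (d := f)) mulr0 !mul0r addr0.
have step e : e <> 0 -> I e -> odd (wt e) = odd (wt p) -> (wt e <= wt p)%N ->
   exists (c : int) (u v w : {poly int}),
    c != 0 /\ cst c%:P * p = cst u * a + cst v * b + cst w * e.
  move=> e0 Ie pare le; have [c [r [c0 lt]]] := wt_reduce e0 p0 pare le.
  have [||c' [u [v [c'0 E]]]] := IHn (cst c%:P * p - cst r * e).
  - by move: wtp; rewrite ltnS; exact: leq_trans.
  - by apply: (ID); [|rewrite -mulNr]; exact: IM.
  exists (c' * c), u, v, (c'%:P * r); split; first by rewrite mulf_neq0.
  by rewrite polyCM !cstM -E mulrBr !mulrA addrNK.
have [e|ne] := eqVneq (odd (wt p)) (odd (wt a)).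
  have [//||c [u [v [w [c0 E]]]]] := step a a0 Ia _.
    exact: mina.
  exists c, (u + w), v; split => //; rewrite E cstD; ring.
have e : odd (wt p) = odd (wt b) by move: par ne; do 3 case: odd.
have [//||c [u [v [w [c0 E]]]]] := step b b0 Ib _.
  exact: minb.
exists c, u, (v + w); split => //; rewrite E cstD; ring.
Qed.

End CoordRing.

(** * Integral polynomials near -oo *)


Definition near_ninfty (P : int -> Prop) : Prop := exists N, forall n, n <= N -> P n.

Lemma near_ninfty_and (P Q : int -> Prop) :
  near_ninfty P -> near_ninfty Q -> near_ninfty (fun n => P n /\ Q n).
Proof.
move=> [M hM] [N hN]; exists (Num.min M N) => n.
by rewrite le_min => /andP[nM nN]; split; [exact: hM|exact: hN].
Qed.

Lemma near_ninfty_imp (P Q : int -> Prop) :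
  (forall n, P n -> Q n) -> near_ninfty P -> near_ninfty Q.
Proof. by move=> PQ [N hN]; exists N => n /hN/PQ. Qed.

Lemma near_ninfty_lt (a : int) : near_ninfty (fun n => n < a).
Proof. by exists (a - 1) => n; lia. Qed.

Lemma near_ninfty_fin (I : finType) (P : I -> int -> Prop) :
  (forall i, near_ninfty (P i)) -> near_ninfty (fun n => forall i, P i n).
Proof.
move=> h; suff [N hN] : near_ninfty (fun n => {in enum I, forall i, P i n}).
  by exists N => n /hN hn i; apply: hn; rewrite mem_enum.
elim: (enum I) => [|i s IHs]; first by exists 0.
apply: near_ninfty_imp (near_ninfty_and (h i) IHs) => n [Pi Ps] j.
by rewrite inE => /predU1P[->|/Ps].
Qed.

(** The factor [|n|] on the left allows the exponent [size p] in place of the degree, which covers p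
    = 0. *)
Lemma horner_upper (p : {poly int}) : exists K : int, forall n : int, n != 0 ->
  `|n| * `|p.[n]| <= K * `|n| ^+ size p.
Proof.
exists (\sum_(i < size p) `|p`_i|) => n n0.
rewrite -normrM horner_coef mulr_sumr mulr_suml.
apply: le_trans (ler_norm_sum _ _ _) _; apply: ler_sum => i _.
rewrite !normrM normrX mulrCA ler_wpM2l // -exprS.
by rewrite ler_weXn2l // -gtz0_ge1 normr_gt0.
Qed.

Lemma horner_lt (p q : {poly int}) : (size p < size q)%N ->
  near_ninfty (fun n => `|p.[n]| < `|q.[n]|).
Proof.
move=> lt.
have q0 : q != 0 by rewrite -size_poly_gt0 (leq_trans _ lt).
pose d := (size q).-1; have szq : size q = d.+1 by rewrite prednK // size_poly_gt0.
pose q' := q - lead_coef q *: 'X^d.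
have szq' : (size q' <= d)%N.
  apply/leq_sizeP => j; rewrite /q' coefB coefZ coefXn leq_eqVlt.
  case/predU1P => [<-|jd]; first by rewrite eqxx mulr1 subrr.
  by rewrite gtn_eqF // mulr0 subr0 nth_default // szq.
have [K hK] := horner_upper p; have [K' hK'] := horner_upper q'.
have K0 : 0 <= K.
  by have := hK (-1) isT; rewrite normrN1 expr1n mul1r mulr1; apply: le_trans.
have K'0 : 0 <= K'.
  by have := hK' (-1) isT; rewrite normrN1 expr1n mul1r mulr1; apply: le_trans.
(* The leading term of q is at least [|n| ^+ d] in absolute value, its coefficient being a nonzero
   integer. It outweighs p and q' together once [|n|] exceeds K + K'. *)
apply: near_ninfty_imp (near_ninfty_lt (- (K + K'))) => n nlt.
have n0 : n != 0 by lia.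
have n1 : 1 <= `|n| by lia.
have hp : `|n| * `|p.[n]| <= K * `|n| ^+ d.
  by apply: le_trans (hK n n0) _; rewrite ler_wpM2l // ler_weXn2l // -ltnS -szq.
have hq' : `|n| * `|q'.[n]| <= K' * `|n| ^+ d.
  by apply: le_trans (hK' n n0) _; rewrite ler_wpM2l // ler_weXn2l.
have lc1 : 1 <= `|lead_coef q| by rewrite -gtz0_ge1 normr_gt0 lead_coef_eq0.
have top : `|n| ^+ d <= `|lead_coef q * n ^+ d|.
  by rewrite normrM normrX ler_peMl // exprn_ge0.
have eq : q.[n] = lead_coef q * n ^+ d + q'.[n].
  by rewrite /q' hornerD hornerN hornerZ hornerXn addrC subrK.
have tri : `|lead_coef q * n ^+ d| <= `|q.[n]| + `|q'.[n]|.
  have -> : lead_coef q * n ^+ d = q.[n] - q'.[n] by rewrite eq addrK.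
  exact: ler_normB.
have X0 : 0 < `|n| ^+ d by rewrite exprn_gt0 // normr_gt0.
rewrite -(ltr_pM2l (x := `|n|)) ?normr_gt0 //.
have big : (K + K') * `|n| ^+ d < `|n| * `|n| ^+ d by rewrite ltr_pM2r //; lia.
have : `|n| * `|n| ^+ d <= `|n| * `|q.[n]| + `|n| * `|q'.[n]|.
  by rewrite -mulrDr ler_wpM2l // (le_trans top).
lia.
Qed.

Lemma horner_neq0 (p : {poly int}) : p != 0 -> near_ninfty (fun n => p.[n] != 0).
Proof.
move=> p0; have [|N hN] := @horner_lt 0 p; first by rewrite size_poly0 size_poly_gt0.
by exists N => n /hN; rewrite horner0 normr0 normr_gt0.
Qed.

Lemma horner_ninfty (f : {poly int}) (K : int) :
  f \is monic -> ~~ odd (size f) -> near_ninfty (fun n => f.[n] < - K).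
Proof.
move=> f_monic f_even.
have f_gt0 : (0 < size f)%N by rewrite size_poly_gt0 monic_neq0.
pose d := (size f).-1.
have sd : size f = d.+1 by rewrite prednK.
(* As d > 0, f + K is still monic of degree d, so near -oo it differs from n^d by less than the
   absolute value of n^d. For n < 0 the power n^d is negative, d being odd. *)
have lt : (size (f + K%:P - 'X^d)%R < size ('X^d : {poly int})%R)%N.
  rewrite size_polyXn ltnS; apply/leq_sizeP => j.
  rewrite coefB coefD coefC coefXn leq_eqVlt => /predU1P[<-|lt].
    have -> : (d == 0)%N = false by move: f_even; rewrite sd; case: (d).
    by rewrite addr0 eqxx -lead_coefE (monicP f_monic) subrr.
  by rewrite nth_default ?sd // !gtn_eqF ?subr0 // (leq_ltn_trans _ lt).
apply: near_ninfty_imp (near_ninfty_and (horner_lt lt) (near_ninfty_lt 0)).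
move=> n [+ n0]; rewrite !hornerE.
have: n ^+ d < 0 by rewrite exprn_odd_lt0 //; move: f_even; rewrite sd /=; case: odd.
move: (n ^+ d) => x x0; lia.
Qed.

(* The remainder of the pseudo-division of [p] by [q] is divisible by [q], but
   smaller, at infinitely many integers. *)
Lemma dvd_of_horner_dvd (p q : {poly int}) : q != 0 ->
  (forall N, exists n, n <= N /\ (q.[n] %| p.[n])%Z) ->
  exists (c : int) (r : {poly int}), c != 0 /\ c *: p = r * q.
Proof.
move=> q0 inf.
pose k := scalp p q; pose c := lead_coef q ^+ k.
have c0 : c != 0 by rewrite expf_neq0 // lead_coef_eq0.
have E : c *: p = (p %/ q) * q + p %% q by exact: Pdiv.Idomain.divp_eq.
exists c, (p %/ q); split => //; rewrite E.
have [->|r0] := eqVneq (p %% q) 0; first by rewrite addr0.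
have lt : (size (p %% q)%R < size q)%N by rewrite ltn_modp.
have [N hN] := near_ninfty_and (horner_lt lt) (horner_neq0 r0).
have [n [/hN[ltn nz] dv]] := inf N; exfalso.
have : (q.[n] %| (p %% q).[n])%Z.
  have -> : (p %% q).[n] = c * p.[n] - (p %/ q).[n] * q.[n].
    by have := congr1 (horner^~ n) E; rewrite !hornerE => ->; ring.
  by rewrite rpredB // dvdz_mull.
move=> /dvdzP[m e]; move: ltn nz; rewrite e normrM.
have [->|m0] := eqVneq m 0; first by move=> _; rewrite mul0r eqxx.
have : 1 <= `|m| by lia.
by move=> m1; rewrite ltNge ler_peMl.
Qed.

(** * Ideals with principal specializations *)


Lemma exists_min (T : Type) (m : T -> nat) (P : T -> Prop) x0 : P x0 ->
  exists2 x, P x & forall y, P y -> (m x <= m y)%N.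
Proof.
have [n] := ubnP (m x0); elim: n x0 => // n IHn x0 /ltnSE lt Px0.
have [[y [Py my]]|h] := pselect (exists y, P y /\ (m y < m x0)%N).
  by apply: IHn Py; exact: leq_trans lt.
exists x0 => // y Py; rewrite leqNgt; apply/negP => my.
by apply: h; exists y.
Qed.

Lemma sqrz_ge1 (u : int) : u != 0 -> 1 <= u ^+ 2.
Proof. by rewrite -gtz0_ge1 exprn_even_gt0. Qed.

(** Put X = u^2 A + v^2 C. The bound 4 B^2 <= A C and the inequality of arithmetic and geometric
    means give |4 u v B| <= X, so the form is at least X / 2, while X >= (u^2 + v^2) A >= A. *)
Lemma form_lower (A B C u v : int) : 0 <= A -> A <= C -> 4 * B ^+ 2 <= A * C ->
  (u != 0) || (v != 0) ->
  A <= 2 * (u ^+ 2 * A + (u * v * B) *+ 2 + v ^+ 2 * C).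
Proof.
move=> A0 AC BAC uv.
have C0 : 0 <= C by exact: le_trans AC.
pose X := u ^+ 2 * A + v ^+ 2 * C.
have X0 : 0 <= X by rewrite addr_ge0 // mulr_ge0 ?sqr_ge0.
have sq : (4 * (u * v * B)) ^+ 2 <= X ^+ 2.
  have h1 : 4 * (u * v) ^+ 2 * (4 * B ^+ 2) <= 4 * (u * v) ^+ 2 * (A * C).
    by rewrite ler_wpM2l // mulr_ge0 // sqr_ge0.
  have h2 : 0 <= (u ^+ 2 * A - v ^+ 2 * C) ^+ 2 by rewrite sqr_ge0.
  have e1 : (4 * (u * v * B)) ^+ 2 = 4 * (u * v) ^+ 2 * (4 * B ^+ 2) by ring.
  have e2 : X ^+ 2 = (u ^+ 2 * A - v ^+ 2 * C) ^+ 2 + 4 * (u * v) ^+ 2 * (A * C).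
    by rewrite /X; ring.
  by rewrite e1 e2; apply: le_trans h1 _; rewrite lerDr.
have abs : `|4 * (u * v * B)| <= X.
  by rewrite -(@ler_pXn2r _ 2) ?nnegrE // -normrX ger0_norm // sqr_ge0.
have : A <= X.
  have h1 : v ^+ 2 * A <= v ^+ 2 * C by rewrite ler_wpM2l // sqr_ge0.
  apply: le_trans (_ : (u ^+ 2 + v ^+ 2) * A <= _); last first.
    by rewrite mulrDl lerD2l.
  rewrite ler_peMl //.
  by case/orP: uv => /sqrz_ge1 h; [rewrite -[1]addr0|rewrite -[1]add0r];
    rewrite lerD // sqr_ge0.
have -> : 2 * (u ^+ 2 * A + (u * v * B) *+ 2 + v ^+ 2 * C) =
          X + (X + 4 * (u * v * B)) by rewrite /X; ring.
have : 0 <= X + 4 * (u * v * B).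
  by rewrite -lerBlDl sub0r; move: abs; rewrite ler_norml => /andP[].
by move=> h /le_trans; apply; rewrite lerDl.
Qed.

Lemma horner_form (P Q S : {poly int}) (u v n : int) :
  (u%:P ^+ 2 * P + (u%:P * v%:P * Q) *+ 2 + v%:P ^+ 2 * S).[n] =
  u ^+ 2 * P.[n] + (u * v * Q.[n]) *+ 2 + v ^+ 2 * S.[n].
Proof. by rewrite !(hornerD, hornerMn, hornerM, horner_exp, hornerC). Qed.

Section Evaluation.
Context {f : {poly int}} (n : int).
Hypothesis fn : f.[n] < 0.

Lemma re_section (p : coord_ring f) :
  re (d := f.[n]) (section_map f n p) = (re (d := f) p).[n].
Proof. by elim/(surdW (d := f)): p => u v; rewrite section_map_surd !re_surd. Qed.

Lemma im_section (p : coord_ring f) :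
  im (d := f.[n]) (section_map f n p) = (im (d := f) p).[n].
Proof. by elim/(surdW (d := f)): p => u v; rewrite section_map_surd !im_surd. Qed.

Lemma section_map_cst (u : {poly int}) :
  section_map f n (surd f u 0) = surd f.[n] u.[n] 0.
Proof. by rewrite section_map_surd horner0. Qed.

Lemma section_map_lin (u v : {poly int}) (p q : coord_ring f) :
  section_map f n (surd f u 0 * p + surd f v 0 * q) =
  surd f.[n] u.[n] 0 * section_map f n p + surd f.[n] v.[n] 0 * section_map f n q.
Proof. by rewrite rmorphD !rmorphM !section_map_cst. Qed.

Lemma qnorm_section (p : coord_ring f) :
  qnorm (d := f.[n]) (section_map f n p) = (qnorm (d := f) p).[n].
Proof. by rewrite /qnorm re_section im_section !hornerE. Qed.

Lemma qnorm_ge0 (z : section_ring f n) : 0 <= qnorm (d := f.[n]) z.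
Proof.
rewrite /qnorm -mulNr addr_ge0 ?sqr_ge0 // mulr_ge0 ?sqr_ge0 //.
by rewrite oppr_ge0 ltW.
Qed.

(** A nonzero imaginary part contributes at least -f(n) > K to the norm. *)
Lemma qnorm_small (K : int) (z : section_ring f n) :
  f.[n] < - K -> qnorm (d := f.[n]) z <= K -> im (d := f.[n]) z = 0.
Proof.
move=> fK; rewrite /qnorm => zK; apply/eqP/negP => /negP i0.
have := sqrz_ge1 i0; have := sqr_ge0 (re (d := f.[n]) z).
move: zK fK fn; move: (f.[n]) (re z) (im z) => t x y zK tK t0 x0 y1.
have : - t <= - t * y ^+ 2 by rewrite ler_peMr // oppr_ge0 ltW.
by move: zK x0; rewrite -mulNr; move: (x ^+ 2) (- t * y ^+ 2) => X Y; lia.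
Qed.

End Evaluation.

Section Ideal.
Context {f : {poly int}}.
Hypothesis f_monic : f \is monic.
Hypothesis f_even : ~~ odd (size f).
Local Notation R := (coord_ring f).
Local Notation cst a := (surd f a 0).
Local Notation wt p := (size (qnorm (d := f) p)).

Variables (J : finType) (e : J -> R) (I : R -> Prop).
Hypothesis ID : forall p q, I p -> I q -> I (p + q).
Hypothesis IM : forall r p, I p -> I (r * p).
Hypothesis Ie : forall j, I (e j).
Hypothesis I_gen : forall p, I p -> exists c : J -> R, p = \sum_j c j * e j.

(** K is only assumed stable under Z[x], so I is generated over Z[x] by the finitely many [e j] and
    y times [e j]. The product of their multipliers then serves for all of I. *)
Lemma uniform_multiplier (K : R -> Prop) :
  K 0 -> (forall p q, K p -> K q -> K (p + q)) ->
  (forall u p, K p -> K (cst u * p)) ->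
  (forall p, I p -> exists c : int, c != 0 /\ K (cst c%:P * p)) ->
  exists c : int, c != 0 /\ forall p, I p -> K (cst c%:P * p).
Proof.
move=> K0 KD KM h.
pose e' (x : bool * J) : R := if x.1 then surd f 0 1 * e x.2 else e x.2.
have Ie' x : I (e' x).
  by rewrite /e'; case: x => [[] j] /=; [exact: IM|exact: Ie].
have [c hc] := choice (fun x => h (e' x) (Ie' x)).
exists (\prod_x c x); split.
  by apply/prodf_neq0 => x _; have [] := hc x.
move=> p /I_gen[r ->].
have Kc x : K (cst (\prod_x c x)%:P * e' x).
  rewrite (bigD1 x) //= [c x * _]mulrC rmorphM /= cstM -mulrA; apply: KM.
  by have [] := hc x.
rewrite mulr_sumr; apply: big_ind => // j _.
have -> : cst (\prod_x c x)%:P * (r j * e j) =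
    cst (re (d := f) (r j)) * (cst (\prod_x c x)%:P * e' (false, j)) +
    cst (im (d := f) (r j)) * (cst (\prod_x c x)%:P * e' (true, j)).
  rewrite {1}[r j](surdE (d := f)) /e' /=.
  have -> : surd f (re (d := f) (r j)) (im (d := f) (r j)) =
    cst (re (d := f) (r j)) + cst (im (d := f) (r j)) * surd f 0 1.
    by rewrite surdM surdD; congr surd; ring.
  ring.
by apply: KD; apply: KM.
Qed.

Definition parity_min a : Prop := [/\ I a, a <> 0 &
  forall p, I p -> p <> 0 -> odd (wt p) = odd (wt a) -> (wt a <= wt p)%N].

Lemma reduced_basis : (exists p, I p /\ p <> 0) -> exists a b : R,
  [/\ parity_min a, parity_min b, (wt a < wt b)%N & odd (wt a) != odd (wt b)].
Proof.
move=> [p [Ip p0]].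
have y0 : surd f 0 1 <> 0 :> R.
  by rewrite -(surd0 (d := f)) => /(@surd_inj _ f)[_ /eqP]; rewrite oner_eq0.
have min q : I q -> q <> 0 -> exists a, parity_min a /\ odd (wt a) = odd (wt q).
  move=> Iq q0.
  have [|a [Ia a0 ea] mina] := @exists_min R (fun p => wt p)
    (fun p => [/\ I p, p <> 0 & odd (wt p) = odd (wt q)]) q; first by [].
  exists a; split => //; split => // r Ir r0 er; apply: mina.
  by split => //; rewrite er.
have [a [ma ea]] := min p Ip p0.
(* Multiplication by y flips the parity of the weight, since N(y) = -f has even size. *)
have [||b [mb eb]] := min (surd f 0 1 * p).
- exact: IM.
- by case/(coord_domain f_monic f_even).
have ab : odd (wt a) != odd (wt b).
  rewrite ea eb (wtM f_monic f_even) //.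
  have -> : wt (surd f 0 1) = size f.
    by rewrite /qnorm re_surd im_surd expr0n expr1n mulr1 sub0r size_polyN.
  have := wt_gt0 f_monic f_even p0; move: f_even.
  by move: (wt p) (size f) => m k; lia.
case: (ltngtP (wt a) (wt b)) => [lt|lt|E].
- by exists a, b.
- by exists b, a; rewrite eq_sym.
- by move: ab; rewrite E eqxx.
Qed.

Definition principal_at n : Prop := exists a : section_ring f n,
  (exists p, I p /\ section_map f n p = a) /\
  (forall p, I p -> exists r, section_map f n p = r * a).

(** The norm of u a + v b is a binary form with coefficients A, 2 B, C. The element w has norm A C,
    of even size because the parities of a and b differ, so deg B^2 < deg (A C). Near -oo this gives
    4 B^2 <= A C and A <= C, as [form_lower] requires. *)
Lemma near_ninfty_reduced (a b : R) : parity_min a -> parity_min b ->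
  (wt a < wt b)%N -> odd (wt a) != odd (wt b) ->
  near_ninfty (fun n => f.[n] < 0 -> forall u v : int, (u != 0) || (v != 0) ->
    (qnorm (d := f) a).[n] <=
      2 * (qnorm (d := f) (cst u%:P * a + cst v%:P * b)).[n]).
Proof.
move=> [_ a0 _] [_ b0 _] lt ab.
set A := qnorm (d := f) a; set C := qnorm (d := f) b in lt ab *.
set w : R := a * surd_conj (d := f) b; set B := re (d := f) w.
have szB : (size (4 *: B ^+ 2)%R < size (A * C)%R)%N.
  have Nw : qnorm (d := f) w = A * C by rewrite (qnormM (d := f)) (qnorm_conj).
  rewrite size_scale // -Nw; apply: norm_even => //; rewrite -/(qnorm (d := f) w) Nw.
    by rewrite mulf_neq0 //; apply/eqP => /(qnorm_eq0 f_monic f_even).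
  have A0 : A != 0 by apply/eqP => /(qnorm_eq0 f_monic f_even).
  have C0 : C != 0 by apply/eqP => /(qnorm_eq0 f_monic f_even).
  move: A0 C0; rewrite -!size_poly_gt0 => A0 C0.
  rewrite size_mul -?size_poly_gt0 //.
  by move: ab A0 C0; rewrite -/A; move: (size A) (size C) => x y; lia.
apply: near_ninfty_imp (near_ninfty_and (horner_lt szB) (horner_lt lt)).
move=> n [lt1 lt2] fn u v uv.
have A0 : 0 <= A.[n] by rewrite -qnorm_section qnorm_ge0.
have C0 : 0 <= C.[n] by rewrite -qnorm_section qnorm_ge0.
rewrite (ger0_norm A0) (ger0_norm C0) in lt2.
rewrite qnorm_lin -/A -/C -/w -/B horner_form.
apply: form_lower => //; first exact: ltW.
move: lt1; rewrite hornerM hornerZ horner_exp (ger0_norm (mulr_ge0 A0 C0)).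
by rewrite (ger0_norm (mulr_ge0 (ler0n _ 4) (sqr_ge0 _))) => /ltW.
Qed.

Lemma generically_principal : (exists p, I p /\ p <> 0) ->
  (forall N, exists n, n <= N /\ principal_at n) ->
  exists a, [/\ I a, a <> 0 & exists c : int, c != 0 /\
    forall p, I p -> exists r, cst c%:P * p = r * a].
Proof.
move=> I_neq0 inf.
have [a [b [ma mb lt ab]]] := reduced_basis I_neq0.
have near := near_ninfty_reduced ma mb lt ab.
case: ma mb => [Ia a0 mina] [Ib b0 minb].
set A := qnorm (d := f) a in near.
(* D is a common denominator for the coordinates of I in the basis a, b. *)
have [D [D0 hD]] : exists D : int, D != 0 /\ forall p, I p ->
    exists u v, cst D%:P * p = cst u * a + cst v * b.
  apply: (@uniform_multiplier (fun p => exists u v, p = cst u * a + cst v * b)).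
  - by exists 0, 0; rewrite (surd0 (d := f)) !mul0r addr0.
  - move=> p q [u [v ->]] [u' [v' ->]]; exists (u + u'), (v + v').
    by rewrite !(cstD (f := f)) !mulrDl addrACA.
  - move=> w p [u [v ->]]; exists (w * u), (w * v).
    by rewrite !(cstM (f := f)) mulrDr !mulrA.
  - move=> p Ip.
    have [c [u [v [c0 E]]]] := euclid_basis f_monic f_even ID IM a0 b0 Ia Ib ab mina minb Ip.
    by exists c; split => //; exists u, v.
(* K will bound the norm of r in a_n = r z, where z generates I_n. The factorial E is a multiple of
   every nonzero integer of absolute value at most K. *)
pose K : int := 2 * D ^+ 2; pose E : int := (`|K|%N)`!%:Z.
have A0 : A != 0 by apply/eqP => /(qnorm_eq0 f_monic f_even).
have [N0 hN0] := near_ninfty_and near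
  (near_ninfty_and (horner_ninfty K f_monic f_even) (horner_neq0 A0)).
(* Write z = q_n. Then D q_n is a nonzero integral combination of a_n and b_n, so N(r) N(z) = N(a_n)
   <= 2 D^2 N(z) and N(r) <= K. As -f(n) > K, r is an integer w dividing E, hence E z is a multiple
   of a_n. *)
have Epr n p : n <= N0 -> principal_at n -> I p -> exists s : section_ring f n,
    section_map f n (cst E%:P * p) = s * section_map f n a.
  move=> /hN0[red [fK An]] [z [[q [Iq qz]] pr]] Ip.
  have D2 : 1 <= D ^+ 2 by exact: sqrz_ge1.
  have fn : f.[n] < 0 by move: fK D2; rewrite /K; lia.
  have [r ar] := pr _ Ia; have [s ps] := pr _ Ip.
  have NA : A.[n] = qnorm (d := f.[n]) r * qnorm (d := f.[n]) z.
    by rewrite -qnorm_section ar (qnormM (d := f.[n])).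
  have Nz : 0 < qnorm (d := f.[n]) z.
    rewrite lt0r qnorm_ge0 // andbT; apply: contraNneq An => h.
    by rewrite NA h mulr0.
  have Nr : 0 < qnorm (d := f.[n]) r.
    rewrite lt0r qnorm_ge0 // andbT; apply: contraNneq An => h.
    by rewrite NA h mul0r.
  have [u [v Dq]] := hD _ Iq.
  have Duv : section_map f n (cst D%:P * q) =
     section_map f n (cst u.[n]%:P * a + cst v.[n]%:P * b).
    by rewrite Dq !section_map_lin !hornerC.
  have NDq : (qnorm (d := f) (cst u.[n]%:P * a + cst v.[n]%:P * b)).[n] =
     D ^+ 2 * qnorm (d := f.[n]) z.
    rewrite -qnorm_section -Duv rmorphM section_map_cst qz (qnormM (d := f.[n])).
    by rewrite (qnorm_surd0 (d := f.[n])) hornerC.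
  have uv : (u.[n] != 0) || (v.[n] != 0).
    apply/negPn; rewrite negb_or !negbK; apply/negP => /andP[/eqP u0 /eqP v0].
    move: NDq; rewrite u0 v0 (surd0 (d := f)) !mul0r addr0 (qnorm0 (f := f)) horner0.
    move/esym/eqP; rewrite mulf_eq0 (gt_eqF Nz) orbF => /eqP h.
    by move: D2; rewrite h.
  have := red fn _ _ uv; rewrite NDq NA mulrA ler_pM2r // -/K => NrK.
  have imr := qnorm_small fn fK NrK.
  set w := re (d := f.[n]) r.
  have rE : r = surd f.[n] w 0 by rewrite [LHS](surdE (d := f.[n])) imr.
  have qw : qnorm (d := f.[n]) r = w ^+ 2.
    by rewrite /qnorm imr expr0n mulr0 subr0.
  have w0 : w != 0 by apply: contraTneq Nr; rewrite qw => ->; rewrite expr0n.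
  have wE : (w %| E)%Z.
    rewrite dvdzE /= dvdn_fact // absz_gt0 w0 /=.
    have : `|w| <= K.
      apply: le_trans NrK; rewrite qw -[w ^+ 2]ger0_norm ?sqr_ge0 // normrX.
      by rewrite expr2 ler_peMl // -gtz0_ge1 normr_gt0.
    by lia.
  have [w' Ew] := dvdzP wE.
  exists (surd f.[n] w' 0 * s).
  rewrite rmorphM section_map_cst ps ar rE hornerC Ew.
  have -> : surd f.[n] (w' * w) 0 = surd f.[n] w' 0 * surd f.[n] w 0.
    by rewrite surdM; congr surd; ring.
  ring.
have E0 : E != 0 by rewrite /E; have := fact_gt0 `|K|%N; lia.
have cj0 : surd_conj (d := f) a <> 0.
  move=> h; apply: a0; apply: (qnorm_eq0 f_monic f_even).
  by rewrite -(qnorm_conj (f := f)) h (qnorm0 (f := f)).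
exists a; split => //.
apply: (@uniform_multiplier (fun p => exists r, p = r * a)).
- by exists 0; rewrite mul0r.
- by move=> p q [r ->] [r' ->]; exists (r + r'); rewrite mulrDl.
- by move=> u p [r ->]; exists (cst u * r); rewrite mulrA.
(* Multiplying by the conjugate of a turns divisibility by a into divisibility of the two
   coordinates of W by the polynomial A. This holds at infinitely many n, hence generically by
   [dvd_of_horner_dvd]. *)
move=> p Ip; set W : R := cst E%:P * p * surd_conj (d := f) a.
have dv N : exists n, [/\ n <= N, (A.[n] %| (re (d := f) W).[n])%Z &
    (A.[n] %| (im (d := f) W).[n])%Z].
  have [n [nN pr]] := inf (Num.min N N0); move: nN; rewrite le_min => /andP[nN nN0].
  have [s hs] := Epr n p nN0 pr Ip; exists n.
  have : section_map f n W = s * surd f.[n] A.[n] 0.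
    rewrite /W rmorphM hs -mulrA -rmorphM mul_surd_conj /=.
    by rewrite section_map_cst.
  elim/(surdW (d := f.[n])): s {hs} => s t; rewrite surdM => hW.
  rewrite -re_section -im_section hW re_surd im_surd !mulr0 addr0 add0r.
  by split => //; exact: dvdz_mull.
have [|c [r [c0 cr]]] := @dvd_of_horner_dvd (re (d := f) W) A A0.
  by move=> N; have [n [? ? _]] := dv N; exists n.
have [|c' [r' [c'0 cr']]] := @dvd_of_horner_dvd (im (d := f) W) A A0.
  by move=> N; have [n [? _ ?]] := dv N; exists n.
exists (c * c' * E); split; first by rewrite !mulf_neq0.
exists (surd f (c' *: r) (c *: r')).
apply: (coord_mulI f_monic f_even cj0).
have -> : surd_conj (d := f) a * (surd f (c' *: r) (c *: r') * a) =
  surd f (c' *: r) (c *: r') * (a * surd_conj (d := f) a) by ring.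
rewrite mul_surd_conj -/A surdM !rmorphM /= !(cstM (f := f)).
have -> : surd_conj (d := f) a * (cst c%:P * cst c'%:P * cst E%:P * p) =
  cst c%:P * cst c'%:P * W by rewrite /W; ring.
rewrite [W](surdE (d := f)) !surdM; congr surd.
  rewrite !mulr0 mul0r !addr0 mulr0 mul0r addr0 -scalerAl -cr -!mul_polyC; ring.
rewrite !mulr0 mul0r !addr0 mul0r addr0 add0r -scalerAl -cr' -!mul_polyC; ring.
Qed.

End Ideal.

(** * Integral generators *)


Lemma map_Fp_eq0 (p : nat) (P : {poly int}) : prime p ->
  map_poly (intr : int -> 'F_p) P = 0 -> exists Q, P = (p%:Z)%:P * Q.
Proof.
move=> p_pr P0; exists (\poly_(i < size P) (P`_i %/ p)%Z).
apply/polyP => i; rewrite coefCM coef_poly; case: ltnP => [lt|le]; last first.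
  by rewrite nth_default // mulr0.
rewrite mulrC divzK // (dvdz_pcharf (pchar_Fp p_pr)).
by rewrite -coef_map P0 coef0.
Qed.

Section Gauss.
Context {f : {poly int}}.
Hypothesis f_monic : f \is monic.
Hypothesis f_even : ~~ odd (size f).
Local Notation R := (coord_ring f).
Local Notation zc a := (surd f a%:P 0).

Lemma zc_neq0 (a : int) : a != 0 -> zc a <> 0 :> R.
Proof.
move=> a0 h; move: (cst_eq0 (f := f) h) => /eqP; rewrite polyC_eq0 => /eqP h'.
by rewrite h' eqxx in a0.
Qed.

Lemma zcM (a b : int) : zc (a * b) = zc a * zc b :> R.
Proof. by rewrite rmorphM (cstM (f := f)). Qed.

(* As [f] has odd degree, it is not a square modulo [p], so that
   [F_p[x, y] / (y ^ 2 - f)] is a domain. *)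
Lemma prime_coord_ring (p : nat) (x y z : R) : prime p -> x * y = zc p%:Z * z ->
  (exists x', x = zc p%:Z * x') \/ (exists y', y = zc p%:Z * y').
Proof.
move=> p_pr E.
pose m := map_poly (intr : int -> 'F_p) : {poly int} -> {poly 'F_p}.
have m_monic : m f \is monic by exact: monic_map.
have m_even : ~~ odd (size (m f)).
  by rewrite size_map_poly_id0 // (monicP f_monic) rmorph1 oner_eq0.
have mp : m (p%:Z)%:P = 0.
  by rewrite /m map_polyC /= -pmulrn pchar_Fp_0.
have key (w : R) : m (qnorm (d := f) w) = 0 -> exists w', w = zc p%:Z * w'.
  rewrite /qnorm /m rmorphB [X in _ - X]rmorphM !rmorphXn /= -/m => h.
  have [hr hi] := norm_eq0 m_monic m_even h.
  have [r er] := map_Fp_eq0 p_pr hr; have [i ei] := map_Fp_eq0 p_pr hi.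
  exists (surd f r i); rewrite [LHS](surdE (d := f)) er ei surdM; congr surd; ring.
have : m (qnorm (d := f) x) * m (qnorm (d := f) y) = 0.
  rewrite -rmorphM -(qnormM (d := f)) E (qnormM (d := f)) (qnorm_surd0 (d := f)).
  by rewrite expr2 -mulrA [LHS]rmorphM [X in X * _]mp mul0r.
by move=> /eqP; rewrite mulf_eq0 => /orP[]/eqP/key; [left|right].
Qed.

(* [a] and [b] generate ideals with product [E]; each prime factor of [E]
   can be divided out of one of them. *)
Lemma gauss_ideals (J : finType) (a b : J -> R) (E : int) : E != 0 ->
  \sum_j a j * b j = zc E -> (forall i j, exists z, a i * b j = zc E * z) ->
  exists e : int, [/\ e != 0, forall i, exists c, a i = zc e * c &
    exists r : J -> R, \sum_j r j * a j = zc e].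
Proof.
have [n] := ubnP `|E|%N; elim: n a b E => // n IHn a b E /ltnSE En E0 sumE divE.
have [E1|E1] := eqVneq `|E|%N 1%N.
  exists 1; split => // [i|]; first by exists (a i); rewrite (surd1 (d := f)) mul1r.
  exists (fun j => zc E * b j).
  rewrite (eq_bigr (fun j => zc E * (a j * b j))); last by move=> j _; ring.
  rewrite -mulr_sumr sumE -zcM; congr (zc _).
  by have [->|->] : E = 1 \/ E = -1 by lia.
pose p := pdiv `|E|.
have p_pr : prime p by apply: pdiv_prime; have := absz_gt0 E; rewrite E0; lia.
have p0 : p%:Z != 0 by have := prime_gt0 p_pr; lia.
have [E' EE'] : exists E', E = p%:Z * E'.
  have /dvdzP[E' ->] : (p %| E)%Z by rewrite dvdzE pdiv_dvd.
  by exists E'; rewrite mulrC.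
have E'0 : E' != 0 by apply: contraNneq E0 => h; rewrite EE' h mulr0.
have E'n : (`|E'| < n)%N.
  apply: leq_trans En; rewrite EE' abszM /=.
  by rewrite ltn_Pmull ?prime_gt1 // absz_gt0.
have pI (x y : R) : zc p%:Z * x = zc p%:Z * y -> x = y.
  by apply: (coord_mulI f_monic f_even); exact: zc_neq0.
have [ap|] := pselect (forall i, exists a', a i = zc p%:Z * a').
  have [a' aE] := choice ap.
  have [|i j|e [e0 ea [r re]]] := IHn a' b E' E'n E'0.
  - apply: pI; rewrite -zcM -EE' -sumE mulr_sumr.
    by apply: eq_bigr => j _; rewrite aE mulrA.
  - have [z hz] := divE i j; exists z; apply: pI.
    by rewrite !mulrA -zcM -EE' -hz aE.
  exists (p%:Z * e); split; first by rewrite mulf_neq0.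
    by move=> i; have [c ac] := ea i; exists c; rewrite aE ac zcM mulrA.
  exists r; rewrite zcM -re mulr_sumr.
  by apply: eq_bigr => j _; rewrite aE; ring.
(* Now p does not divide [a i0] but divides every [a i0 * b j]; being prime in R, it divides every
   [b j]. *)
move=> /existsNP[i0 ni0].
have /choice[b' bE] : forall j, exists b', b j = zc p%:Z * b'.
  move=> j; have [z hz] := divE i0 j.
  have [] := @prime_coord_ring p (a i0) (b j) (zc E' * z) p_pr => //.
  by rewrite hz EE' zcM mulrA.
apply: (IHn a b' E' E'n E'0) => [|i j].
  apply: pI; rewrite -zcM -EE' -sumE mulr_sumr.
  by apply: eq_bigr => j _; rewrite bE; ring.
have [z hz] := divE i j; exists z; apply: pI.
by rewrite !mulrA -zcM -EE' -hz bE; ring.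
Qed.

End Gauss.

(** * Tensor products and invertible modules *)


Section TensorTheory.
Variables (R S : comNzRingType) (phi : {rmorphism R -> S}).
Variables (M : lmodType S) (N : lmodType R).
Local Notation T := (tensor phi M N).

Definition pure m n : T := tensor_of phi [:: (m, n)].

Lemma tensor_ofD s t : tensor_of phi s + tensor_of phi t = tensor_of phi (s ++ t) :> T.
Proof. exact: tensor_addE. Qed.

Lemma scale_pure a m n : a *: pure m n = pure (a *: m) n.
Proof. exact: tensor_scaleE. Qed.

Lemma pureDl m m' n : pure (m + m') n = pure m n + pure m' n.
Proof. exact: tensor_of_pureD. Qed.

Lemma pureDr m n n' : pure m (n + n') = pure m n + pure m n'.
Proof. by rewrite tensor_ofD; apply/tensor_ofP/tensor_eq_Dr. Qed.

Lemma pureZr r m n : pure m (r *: n) = pure (phi r *: m) n.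
Proof. by apply/esym/tensor_ofP/tensor_eq_Z. Qed.

Lemma pure0l n : pure 0 n = 0.
Proof. by apply/tensor_ofP/tensor_eq_0l. Qed.

Lemma pure0r m : pure m 0 = 0.
Proof. by rewrite -(scale0r 0) pureZr rmorph0 scale0r pure0l. Qed.

Lemma pure_suml (J : finType) (F : J -> M) n :
  pure (\sum_j F j) n = \sum_j pure (F j) n.
Proof. by apply: (big_morph (pure^~ n)) => [m m'|]; [exact: pureDl|exact: pure0l]. Qed.

Lemma pure_sumr (J : finType) m (F : J -> N) :
  pure m (\sum_j F j) = \sum_j pure m (F j).
Proof. by apply: (big_morph (pure m)) => [n n'|]; [exact: pureDr|exact: pure0r]. Qed.

Lemma tensor_of_sum s : tensor_of phi s = \sum_(x <- s) pure x.1 x.2 :> T.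
Proof.
elim: s => [|[m n] s IHs]; first by rewrite big_nil.
by rewrite big_cons -cat1s -tensor_ofD IHs.
Qed.

Lemma tensor_pure_ind (P : T -> Prop) :
  P 0 -> (forall x y, P x -> P y -> P (x + y)) -> (forall m n, P (pure m n)) ->
  forall x, P x.
Proof.
move=> P0 PD Pp; elim/tensorW; elim=> [//|[m n] s IHs].
by rewrite -cat1s -tensor_ofD; apply: PD => //; exact: Pp.
Qed.

(** The universal property: the sum of g over a formal sum respects every generator of [tensor_eq],
    so it may be evaluated on representatives. *)
Lemma tensor_lift_exists (P : lmodType S) (g : M -> N -> P) :
  (forall m m' n, g (m + m') n = g m n + g m' n) ->
  (forall m n n', g m (n + n') = g m n + g m n') ->
  (forall a m n, g (a *: m) n = a *: g m n) ->
  (forall r m n, g (phi r *: m) n = g m (r *: n)) ->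
  exists h : {linear T -> P}, forall m n, h (pure m n) = g m n.
Proof.
move=> gDl gDr gZ gA.
pose G (s : seq (M * N)) := \sum_(x <- s) g x.1 x.2.
have G_cat s t : G (s ++ t) = G s + G t by rewrite /G big_cat.
have G1 m n : G [:: (m, n)] = g m n by rewrite /G big_seq1.
have g0 n : g 0 n = 0 by rewrite -(scale0r 0) gZ scale0r.
have Geq s t : tensor_eq phi s t -> G s = G t.
  elim=> {s t} //.
  - by move=> s t u _ -> _ ->.
  - by move=> s s' t t' _ e _ e'; rewrite !G_cat e e'.
  - by move=> s t; rewrite !G_cat addrC.
  - by move=> n; rewrite G1 g0 /G big_nil.
  - by move=> m m' n; rewrite -[RHS]/(G ([:: (m, n)] ++ [:: (m', n)])) G_cat !G1.
  - by move=> m n n'; rewrite -[RHS]/(G ([:: (m, n)] ++ [:: (m, n')])) G_cat !G1.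
  - by move=> r m n; rewrite !G1.
pose h (x : T) : P := G (repr x).
have hE s : h (tensor_of phi s) = G s by apply: Geq; exact: repr_tensor_of.
have h_lin : linear h.
  move=> a; elim/tensorW=> s; elim/tensorW=> t.
  have -> : a *: (tensor_of phi s : T) = tensor_of phi (tensor_map ( *:%R a) s).
    exact: tensor_scaleE.
  rewrite tensor_ofD !hE G_cat; congr (_ + _).
  rewrite /G big_map scaler_sumr; apply: eq_bigr => x _; exact: gZ.
pose hL : {linear T -> P} := HB.pack h (GRing.isLinear.Build _ _ _ _ h h_lin).
by exists hL => m n; rewrite -G1 -hE.
Qed.

Lemma tensor_form_exists (q : {linear M -> S^o}) (q' : {linear N -> R^o}) :
  exists h : {linear T -> S^o}, forall m n, h (pure m n) = q m * phi (q' n).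
Proof.
apply: tensor_lift_exists => [m m' n|m n n'|a m n|r m n].
- by rewrite linearD mulrDl.
- by rewrite linearD rmorphD mulrDr.
- by rewrite linearZ /= scalerAl.
- by rewrite !linearZ /= rmorphM mulrCA mulrA.
Qed.

Definition tensor_form (q : {linear M -> S^o}) (q' : {linear N -> R^o}) :
  {linear T -> S^o} := projT1 (cid (tensor_form_exists q q')).

Lemma tensor_formE q q' m n :
  tensor_form q q' (pure m n) = q m * phi (q' n) :> S.
Proof. by rewrite /tensor_form; case: cid => h /= ->. Qed.

End TensorTheory.
Arguments pure {R S} phi {M N} m n.
Arguments tensor_form {R S} phi {M N} q q'.

(** * Invertible modules over a domain as projective modules of rank one *)

Definition is_domain (R : comNzRingType) : Prop :=
  forall a b : R, a * b = 0 -> a = 0 \/ b = 0.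

Section Line.
Context {R : comNzRingType}.
Implicit Types P : lmodType R.

(* [P] is projective, with dual basis [(p, q)]; the last two conditions say that
   it has rank one. *)
Definition line P : Prop :=
  exists (J : finType) (p : J -> P) (q : J -> {linear P -> R^o}),
    [/\ forall x, x = \sum_j (q j x : R) *: p j,
        \sum_j (q j (p j) : R) = 1 &
        forall j x y, (q j x : R) *: y = (q j y : R) *: x].

Lemma line_regular : line R^o.
Proof.
exists unit, (fun=> 1 : R^o), (fun=> idfun : {linear R^o -> R^o}).
split=> [x||_ x y]; rewrite ?big_const ?cardT ?enumT ?unlock /=.
- by rewrite addr0 /GRing.scale /= mulr1.
- by rewrite addr0.
- by rewrite /GRing.scale /= mulrC.
Qed.

Lemma pure_scale2 (L M : lmodType R) (a b : R) (l : L) (m : M) :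
  pure idfun (a *: l) (b *: m) = pure idfun ((a * b) *: l) m.
Proof. by rewrite pureZr /= scalerA mulrC. Qed.

Lemma line_tensor (L M : lmodType R) : line L -> line M -> line (tensor_product L M).
Proof.
move=> [J [p [q [pq1 pq2 pq3]]]] [J' [p' [q' [pq1' pq2' pq3']]]].
exists (J * J')%type, (fun j => pure idfun (p j.1) (p' j.2)),
  (fun j => tensor_form idfun (q j.1) (q' j.2)).
have sw (j : J * J') x y :
  (tensor_form idfun (q j.1) (q' j.2) x : R) *: y =
  (tensor_form idfun (q j.1) (q' j.2) y : R) *: x.
  elim/tensor_pure_ind: x.
  - by rewrite linear0 scale0r scaler0.
  - by move=> x x' ex ex'; rewrite linearD scalerDl ex ex' scalerDr.
  move=> l m; elim/tensor_pure_ind: y.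
  - by rewrite scaler0 linear0 scale0r.
  - by move=> x x' ex ex'; rewrite scalerDr linearD scalerDl -ex -ex'.
  move=> l' m'; rewrite !tensor_formE /= !scale_pure.
  by rewrite -!pure_scale2 pq3 pq3'.
split => // [x|].
  elim/tensor_pure_ind: x => [|x x' ex ex'|l m].
  - by rewrite big1 // => j _; rewrite linear0 scale0r.
  - rewrite [in LHS]ex [in LHS]ex' -big_split; apply: eq_bigr => j _ /=.
    by rewrite linearD scalerDl.
  rewrite [in LHS](pq1 l) [in LHS](pq1' m) pure_suml -(pair_bigA _
    (fun j j' => (tensor_form idfun (q j) (q' j') (pure idfun l m) : R) *:
      pure idfun (p j) (p' j'))) /=.
  apply: eq_bigr => j _; rewrite pure_sumr; apply: eq_bigr => j' _.
  by rewrite tensor_formE /= scale_pure pure_scale2.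
transitivity ((\sum_j (q j (p j) : R)) * (\sum_j (q' j (p' j) : R))).
  rewrite big_distrlr /= pair_bigA; apply: eq_bigr => j _.
  by rewrite tensor_formE.
by rewrite pq2 pq2' mulr1.
Qed.

Section LineTheory.
Variable P : lmodType R.
Hypothesis lineP : line P.

Lemma line_swap (q : {linear P -> R^o}) (x y : P) : (q x : R) *: y = (q y : R) *: x.
Proof.
have [J [p [r [pr1 _ pr3]]]] := lineP.
rewrite [LHS]pr1 [RHS]pr1; apply: eq_bigr => j _; congr (_ *: _).
rewrite !linearZ /=; have := congr1 q (pr3 j x y); rewrite !linearZ /=.
by rewrite /GRing.scale /= mulrC => ->; rewrite mulrC.
Qed.

Lemma line_torsion_free (a : R) (x : P) : is_domain R -> a <> 0 -> a *: x = 0 -> x = 0.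
Proof.
move=> dom a0 ax; have [J [p [r [pr1 _ _]]]] := lineP.
rewrite (pr1 x) big1 // => j _.
have : a * (r j x : R) = 0 by have := congr1 (r j) ax; rewrite linearZ linear0.
by move=> /dom[//|->]; rewrite scale0r.
Qed.

(** This lets a nonzero form identify P with an ideal of R. By [line_swap], an element of the kernel
    is killed by the nonzero scalar [q y]. *)
Lemma line_form_inj (q : {linear P -> R^o}) : is_domain R ->
  (exists y, q y <> 0) -> injective q.
Proof.
move=> dom [y qy] x x' /eqP; rewrite -subr_eq0 -linearB => /eqP e.
apply/subr0_eq/(line_torsion_free dom qy).
by rewrite line_swap e scale0r.
Qed.

Lemma line_pic_zero (x0 : P) : is_domain R -> x0 <> 0 ->
  (forall x, exists a : R, x = a *: x0) -> pic_zero P.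
Proof.
move=> dom x00 gen; have [J [p [r [pr1 _ _]]]] := lineP.
have [c pc] := choice (fun j => gen (p j)).
(* The coordinate along x0 is defined through the dual basis, which makes it linear. *)
pose h (x : P) : R^o := \sum_j (r j x : R) * c j.
have h_lin : linear h.
  move=> a x y; rewrite /h scaler_sumr -big_split; apply: eq_bigr => j _ /=.
  by rewrite linearP mulrDl scalerAl.
pose hL : {linear P -> R^o} := HB.pack h (GRing.isLinear.Build _ _ _ _ h h_lin).
have hx x : x = (h x : R) *: x0.
  rewrite [LHS]pr1 /h scaler_suml; apply: eq_bigr => j _.
  by rewrite {1}pc scalerA.
exists hL, (fun a : R^o => (a : R) *: x0) => [x|a] /=; first by rewrite -hx.
apply/eqP; rewrite -subr_eq0; apply/eqP; apply: contrapT => h0.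
by apply: x00; apply: (line_torsion_free dom h0); rewrite scalerBl -hx subrr.
Qed.

End LineTheory.

(** The isomorphism of the tensor product with R is a pairing B. Writing the preimage of 1 as a sum
    of pure tensors of l_i and m_i, the dual basis consists of the l_i and the forms B(-, m_i). *)
Lemma invertible_line (L : lmodType R) : is_domain R -> invertible L -> line L.
Proof.
move=> dom [M [h [g hK gK]]].
pose B (l : L) (m : M) : R := h (pure idfun l m).
have hI : injective h := can_inj hK.
have hB l m : pure idfun l m = B l m *: g 1.
  by apply: hI; rewrite linearZ gK /= /GRing.scale /= mulr1.
have BDl l l' m : B (l + l') m = B l m + B l' m.
  by rewrite /B -linearD -pureDl.
have BZl a l m : B (a *: l) m = a * B l m.
  by rewrite /B -scale_pure linearZ.
have BDr l m m' : B l (m + m') = B l m + B l m'.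
  by rewrite /B -linearD -pureDr.
have BZr a l m : B l (a *: m) = a * B l m.
  by rewrite -BZl /B pureZr.
have Bsum : \sum_(x <- repr (g 1)) B x.1 x.2 = 1.
  transitivity (h (g 1)); last by rewrite gK.
  have E : g 1 = tensor_of idfun (repr (g 1)) by rewrite /tensor_of reprK.
  by rewrite [in RHS]E (tensor_of_sum idfun) linear_sum.
have evB l' : exists b : {linear tensor_product L M -> L},
    forall l m, b (pure idfun l m) = B l' m *: l.
  apply: tensor_lift_exists => [l l2 m|l m m2|a l m|a l m].
  - by rewrite scalerDr.
  - by rewrite BDr scalerDl.
  - by rewrite !scalerA mulrC.
  - by rewrite BZr /= scalerA mulrC.
have nondeg l : (forall m, B l m = 0) -> l = 0.
  move=> Bl; rewrite -[l]scale1r -Bsum scaler_suml big1_seq // => -[l' m] _ /=.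
  have [b bE] := evB l'; rewrite -bE.
  have -> : pure idfun l m = 0 by apply: hI; rewrite linear0; exact: Bl.
  by rewrite linear0.
(* Every pure tensor of l and m is B(l, m) times [g 1], so the left side is B(l, m) times [b (g 1)].
   That [b (g 1)] equals l' is tested against each m2, cancelling a nonzero value B(l2, m2) in the
   domain R. *)
have swap l l' m : B l' m *: l = B l m *: l'.
  have [b bE] := evB l'.
  have th l2 m2 : B l' m2 *: l2 = B l2 m2 *: b (g 1) by rewrite -bE hB linearZ.
  rewrite th; congr (_ *: _); apply/subr0_eq/nondeg => m2.
  have BN x : B (- x) m2 = - B x m2 by rewrite -scaleN1r BZl mulN1r.
  rewrite BDl BN; have [[l2 Bl2]|no] := pselect (exists l2, B l2 m2 <> 0).
    have := congr1 (B^~ m2) (th l2 m2); rewrite !BZl => e.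
    have /dom[//|] : B l2 m2 * (B (b (g 1)) m2 - B l' m2) = 0.
      by rewrite mulrBr -e mulrC subrr.
    by [].
  have B0 x : B x m2 = 0 by apply: contrapT => nx; apply: no; exists x.
  by rewrite !B0 subrr.
have xE x : x = \sum_(z <- repr (g 1)) B x z.2 *: z.1.
  rewrite -[LHS]scale1r -[X in X *: _ = _]Bsum scaler_suml.
  by apply: eq_bigr => z _; rewrite swap.
pose t := in_tuple (repr (g 1)).
have qlin j : linear (fun l : L => B l (tnth t j).2 : R^o).
  by move=> a x y; rewrite BDl BZl.
exists 'I_(size (repr (g 1))), (fun j => (tnth t j).1),
  (fun j => HB.pack (fun l : L => B l (tnth t j).2 : R^o)
     (GRing.isLinear.Build _ _ _ _ (fun l : L => B l (tnth t j).2 : R^o) (qlin j))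
     : {linear L -> R^o}).
rewrite /=; split=> [x||j x y] /=; last exact: swap.
  by rewrite [LHS]xE [LHS]big_tnth.
by rewrite -[RHS]Bsum [RHS]big_tnth.
Qed.

End Line.

(** * Specialization and descent *)


Section Reduction.
Context {R S : comNzRingType} {phi : {rmorphism R -> S}}.

(* Some form on [P'] has as image the reduction by [phi] of the ideal [q P]. *)
Definition reduces_to (P : lmodType R) (q : {linear P -> R^o}) (P' : lmodType S) :=
  exists q' : {linear P' -> S^o},
    (forall x, exists p, q' x = phi (q p)) /\ (forall p, exists x, q' x = phi (q p)).

Hypothesis phi_surj : forall s, exists r, phi r = s.

Lemma reduces_to_regular : reduces_to (idfun : {linear R^o -> R^o}) S^o.
Proof.
exists idfun; split=> [s|r]; last by exists (phi r).
by have [r <-] := phi_surj s; exists r.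
Qed.

Lemma reduces_to_pullback (P : lmodType R) (q : {linear P -> R^o}) :
  reduces_to q (pullback phi P).
Proof.
exists (tensor_form phi idfun q); split=> [|p]; last first.
  by exists (pure phi (1 : S^o) p); rewrite tensor_formE /= mul1r.
elim/tensor_pure_ind => [|x y [p hp] [p' hp']|s p].
- by exists 0; rewrite !linear0 rmorph0.
- by exists (p + p'); rewrite !linearD rmorphD hp hp'.
have [r <-] := phi_surj s; exists (r *: p).
by rewrite tensor_formE linearZ /= rmorphM.
Qed.

(** Together with [reduces_to_pullback], this handles powers of a pull-back without comparing them
    with the pull-back of the powers. *)
Lemma reduces_to_tensor (P Q : lmodType R) (q : {linear P -> R^o})
    (r : {linear Q -> R^o}) (P' Q' : lmodType S) :
  reduces_to q P' -> reduces_to r Q' ->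
  reduces_to (tensor_form idfun q r : {linear tensor_product P Q -> R^o})
    (tensor_product P' Q').
Proof.
move=> [q' [q1 q2]] [r' [r1 r2]].
exists (tensor_form idfun q' r'); split.
  elim/tensor_pure_ind => [|x y [p hp] [p' hp']|x y].
  - by exists 0; rewrite !linear0 rmorph0.
  - by exists (p + p'); rewrite !linearD rmorphD hp hp'.
  have [p hp] := q1 x; have [p' hp'] := r1 y; exists (pure idfun p p').
  by rewrite !tensor_formE /= hp hp' rmorphM.
elim/tensor_pure_ind => [|x y [p hp] [p' hp']|x y].
- by exists 0; rewrite !linear0 rmorph0.
- by exists (p + p'); rewrite !linearD rmorphD hp hp'.
have [p hp] := q2 x; have [p' hp'] := r2 y; exists (pure idfun p p').
by rewrite !tensor_formE /= hp hp' rmorphM.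
Qed.

End Reduction.
Arguments reduces_to {R S} phi {P} q P'.

Section Main.
Context {f : {poly int}}.
Hypothesis f_monic : f \is monic.
Hypothesis f_even : ~~ odd (size f).
Local Notation R := (coord_ring f).
Local Notation zc a := (surd f a%:P 0).

Let dom : is_domain R := coord_domain f_monic f_even.

(** Write E p_j = a_j x0 and b_j = q_j(x0). Then a_i b_j = E q_j(p_i), and the a_j b_j sum to E by
    the rank one condition, so [gauss_ideals] yields an integer e generating the ideal of the a_j.
    The element y0 with E y0 = e x0 generates P. *)
Lemma line_descent (P : lmodType R) (x0 : P) (E : int) : line P ->
  E != 0 -> (forall x, exists r : R, zc E *: x = r *: x0) -> pic_zero P.
Proof.
move=> lineP E0 gen; have [J [p [q [pq1 pq2 pq3]]]] := lineP.
have [a ha] := choice (fun j => gen (p j)).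
have zI := zc_neq0 (f := f).
have ab i j : a i * (q j x0 : R) = zc E * (q j (p i) : R).
  by have := congr1 (q j) (ha i); rewrite !linearZ => /esym.
have [||e [e0 ea [r re]]] := @gauss_ideals f f_monic f_even J a
    (fun j => q j x0 : R) E E0.
- by rewrite (eq_bigr _ (fun j _ => ab j j)) -mulr_sumr pq2 mulr1.
- by move=> i j; exists (q j (p i) : R); exact: ab.
pose y0 := \sum_j r j *: p j.
have Ey0 : zc E *: y0 = zc e *: x0.
  rewrite scaler_sumr -re scaler_suml; apply: eq_bigr => j _.
  by rewrite scalerA mulrC -scalerA ha scalerA.
have cancelE x y : zc E *: x = zc E *: y -> x = y :> P.
  move=> /eqP; rewrite -subr_eq0 -scalerBr => /eqP h.
  by apply/subr0_eq/(line_torsion_free lineP dom (zI _ E0)).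
have py0 j : exists c : R, p j = c *: y0.
  have [c ac] := ea j; exists c; apply: cancelE.
  by rewrite ha ac mulrC -scalerA -Ey0 !scalerA mulrC.
have [c hc] := choice py0.
apply: (line_pic_zero lineP (x0 := y0)) => // [y00|x].
  have /eqP := pq2; rewrite big1 ?(eq_sym 0) ?oner_eq0 // => j _.
  by rewrite hc y00 scaler0 linear0.
exists (\sum_j (q j x : R) * c j).
by rewrite [LHS]pq1 scaler_suml; apply: eq_bigr => j _; rewrite {1}hc scalerA.
Qed.

(** If [P' n] were trivial for n arbitrarily close to -oo, the ideal I = q(P) would be principal at
    these n. Then [generically_principal] makes it principal up to an integer, and [line_descent]
    removes this integer. *)
Lemma near_ninfty_nontrivial (P : lmodType R) (q : {linear P -> R^o})
    (P' : forall n, lmodType (section_ring f n)) :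
  line P -> (exists x, q x <> 0) ->
  (forall n, reduces_to (section_map f n) q (P' n)) ->
  ~ pic_zero P -> near_ninfty (fun n => ~ pic_zero (P' n)).
Proof.
move=> lineP q0 red; apply: contra_notP => far.
have [J [p [r [pr1 _ _]]]] := lineP.
pose I (z : R) := exists x, z = q x.
have [|||||N|a [[x0 ->] _ [E [E0 hE]]]] :=
  @generically_principal f f_monic f_even J (fun j => q (p j)) I.
- by move=> _ _ [x ->] [y ->]; exists (x + y); rewrite linearD.
- by move=> a _ [x ->]; exists (a *: x); rewrite linearZ.
- by move=> j; exists (p j).
- move=> _ [x ->]; exists (fun j => r j x).
  by rewrite {1}(pr1 x) linear_sum; apply: eq_bigr => j _; rewrite linearZ.
- by have [x qx] := q0; exists (q x); split => //; exists x.
- have [n [nN [h [g hK gK]]]] : exists n, n <= N /\ pic_zero (P' n).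
    apply: contrapT => no; apply: far; exists N => n nN pz; apply: no.
    by exists n.
  exists n; split => //; have [q' [q1 q2]] := red n.
  (* The generator is the value of q' at the basis element of [P' n]. *)
  exists (q' (g 1)); split.
    by have [x e] := q1 (g 1); exists (q x); split => //; exists x.
  move=> _ [x ->]; have [y <-] := q2 x; exists (h y).
  have {1}-> : y = (h y : section_ring f n) *: g 1.
    by apply: (can_inj hK); rewrite linearZ gK /= /GRing.scale /= mulr1.
  by rewrite linearZ.
apply: (line_descent (x0 := x0) lineP E0) => x.
have [|s e] := hE (q x); first by exists x.
exists s; apply: (line_form_inj lineP dom q0).
by rewrite !linearZ.
Qed.

Lemma line_nonzero_form (P : lmodType R) : line P ->
  exists (q : {linear P -> R^o}) x, q x <> 0.
Proof.
move=> [J [p [q [_ pq2 _]]]]; apply: contrapT => no.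
have /eqP := pq2; rewrite big1 ?(eq_sym 0) ?oner_eq0 // => j _.
by apply: contrapT => h; apply: no; exists (q j), (p j).
Qed.

(** A single form Q serves for all n, as [near_ninfty_nontrivial] demands. *)
Lemma tensor_power_reduces (L : lmodType R) (k : nat) : line L ->
  line (tensor_power L k) /\
  exists Q : {linear tensor_power L k -> R^o},
    (exists x, Q x <> 0) /\
    forall n, reduces_to (section_map f n) Q
      (tensor_power (pullback (section_map f n) L) k).
Proof.
move=> lineL; elim: k => [|k [lineLk [Q [[x Qx] redQ]]]] /=.
  split; first exact: line_regular.
  exists idfun; split; first by exists (1 : R); exact/eqP/oner_neq0.
  by move=> n; apply: reduces_to_regular; exact: section_map_surj.
split; first exact: line_tensor.
have [q [y qy]] := line_nonzero_form lineL.
exists (tensor_form idfun q Q); split.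
  by exists (pure idfun y x); rewrite tensor_formE => /dom[].
move=> n; apply: reduces_to_tensor => //.
by apply: reduces_to_pullback; exact: section_map_surj.
Qed.

End Main.

Unset Implicit Arguments.
Local Open Scope classical_set_scope.

Theorem theorem1p2 (g : nat) (g_ge1 : (1 <= g)%N)
    (f : {poly int}) (f_monic : f \is monic)
    (f_deg : size f = (2 * g + 1)%N.+1) (f_sqfree : square_free f)
    (L : lmodType (coord_ring f)) (L_inv : invertible L) :
  (~ pic_zero L ->
     infinite_set [set n : int |
       [/\ n < 0, f.[n] < 0 & ~ pic_zero (pullback (section_map f n) L)]]) /\
  (infinite_order L ->
     forall (b : nat) (N : int), exists n : int,
       [/\ n <= N, f.[n] < 0 & order_gt b (pullback (section_map f n) L)]).
Proof.
have f_even : ~~ odd (size f) by rewrite f_deg; lia.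
have dom : is_domain (coord_ring f) := coord_domain f_monic f_even.
have lineL := invertible_line dom L_inv.
have f_neg := horner_ninfty 0 f_monic f_even.
split=> [L_nz|L_inf b N].
  have [q q0] := line_nonzero_form lineL.
  have near : near_ninfty (fun n => ~ pic_zero (pullback (section_map f n) L)).
    apply: (near_ninfty_nontrivial f_monic f_even lineL q0) => // n.
    by apply: reduces_to_pullback; exact: section_map_surj.
  have [M hM] := near_ninfty_and (near_ninfty_lt 0) (near_ninfty_and f_neg near).
  (* All n below some M have the required properties. *)
  apply: (@sub_infinite_set _ [set n | n <= M]).
    by move=> n /= /hM[n0 [fn nz]]; rewrite oppr0 in fn.
  apply/infiniteP.
  have [|F] := (@injfunPex nat int [set: nat] [set n | n <= M]).2.
    exists (fun k : nat => M - k%:Z) => [k _ /=|k k' _ _ /=]; first by rewrite gerBl.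
    by lia.
  exact: inj_card_le F.
(* Each power of L with exponent from 1 to b stays nontrivial near -oo; these finitely many
   conditions hold together near -oo. *)
have near : near_ninfty (fun n => forall k : 'I_b.+1,
    (0 < k)%N -> ~ pic_zero (tensor_power (pullback (section_map f n) L) k)).
  apply: near_ninfty_fin => k; have [k0|k0] := posnP k.
    by exists 0 => n _; rewrite k0.
  have [lineLk [Q [Q0 redQ]]] := tensor_power_reduces f_monic f_even k lineL.
  have := near_ninfty_nontrivial f_monic f_even lineLk Q0 redQ (L_inf k k0).
  by apply: near_ninfty_imp => n h _.
have [M hM] := near_ninfty_and f_neg near.
exists (Num.min M N); have [|fn nz] := hM (Num.min M N); first by rewrite ge_min lexx.
split; first by rewrite ge_min lexx orbT.
  by rewrite oppr0 in fn.
move=> k /andP[k0 kb]; have kb' : (k < b.+1)%N by [].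
exact: (nz (Ordinal kb')).
Qed.
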